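(* Let $H$ be a separable infinite-dimensional complex Hilbert space, let $T\in B(H)$ be an invertible operator, and let $B\subset(\mathbb N\times\mathbb N)\setminus\Delta$ be an admissible set. Assume that there exist $s>r>0$ such that $s\mathbb T\cup r\mathbb T\subset\sigma_e(T)$, where $\mathbb T$ stands for the unit circle. Then for every $k\in\mathbb N$ there exists an orthonormal basis $(u_n)_{n\in\mathbb N}$ of $H$ such that $$\langle T^lu_j,u_n\rangle=0$$ for all $l=\pm1,\dots,\pm k$ and all $(n,j)\in B\cup\Delta$.
   Context: $B(H)$ is the space of bounded linear operators on $H$; $\mathbb N=\{1,2,\dots\}$. $\sigma_e(T)$ is the essential spectrum of $T$, i.e. the spectrum of $T+\mathcal K(H)$ in the Calkin algebra $B(H)/\mathcal K(H)$, where $\mathcal K(H)$ is the ideal of compact operators. $\Delta=\{(n,n):n\in\mathbb N\}$. A set $B\subset(\mathbb N\times\mathbb N)\setminus\Delta$ is admissible if for every $m\in\mathbb N$ there exists $n\in\mathbb N$, $n>m$, such that $(j,n)\notin B$ and $(n,j)\notin B$ for all $j=1,\dots,m$. *)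

(* Defs.v *)
From HB Require Import structures.
From mathcomp Require Import all_boot all_order all_algebra.
From mathcomp Require Import sesquilinear ring_quotient.
From mathcomp Require Export complex.
From mathcomp Require Import all_classical all_reals all_analysis.

Set Implicit Arguments.
Unset Strict Implicit.
Unset Printing Implicit Defensive.

Import Order.TTheory GRing.Theory Num.Theory.
Import numFieldNormedType.Exports.

Local Open Scope classical_set_scope.
Local Open Scope ring_scope.
Local Open Scope quotient_scope.

Section Invertible.
Context {A : pzRingType}.

Definition invertible (a : A) := exists b : A, b * a = 1 /\ a * b = 1.

(* Equal to 0 when [a] is not invertible. *)
Definition inverse (a : A) : A := xget 0 [set b | b * a = 1 /\ a * b = 1].

Definition int_power (a : A) (l : int) : A :=
  match l with
  | Posz n => a ^+ n
  | Negz n => inverse a ^+ n.+1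
  end.

End Invertible.

Section BoundedOperators.
Context {K : numFieldType} (V : normedModType K).

Definition bounded_linear : {pred V -> V} :=
  mem [set f : V -> V |
    linear f /\ exists M : K, forall x, `|f x| <= M * `|x|].

Record bounded_op := BoundedOp {
  bounded_op_fun :> V -> V;
  bounded_op_subproof : bounded_op_fun \in bounded_linear
}.

HB.instance Definition _ := [isSub for bounded_op_fun].
HB.instance Definition _ := [Choice of bounded_op by <:].

Lemma bounded_linear_submod_closed : submod_closed bounded_linear.
Proof.
split=> [|a f g].
  rewrite inE; split=> [k x y|]; first by rewrite scaler0 addr0.
  by exists 0 => x; rewrite normr0 mul0r.
rewrite !inE => -[lf [M fM]] [lg [N gN]]; split=> [k x y|].
  change (a *: f (k *: x + y) + g (k *: x + y) =
          k *: (a *: f x + g x) + (a *: f y + g y)).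
  rewrite lf lg !scalerDr addrACA; congr (_ + _); congr (_ + _).
  by rewrite !scalerA mulrC.
exists (`|a| * M + N) => x; rewrite mulrDl; apply: le_trans (ler_normD _ _) _.
by apply: lerD (gN x); rewrite normrZ -mulrA ler_wpM2l.
Qed.

HB.instance Definition _ :=
  GRing.isSubmodClosed.Build K (V -> V) bounded_linear
    bounded_linear_submod_closed.
HB.instance Definition _ := [SubChoice_isSubLmodule of bounded_op by <:].

Lemma bounded_opP (T : bounded_op) :
  linear T /\ exists M : K, forall x, `|T x| <= M * `|x|.
Proof. by have := bounded_op_subproof T; rewrite inE. Qed.

Lemma bounded_op_eqP (S T : bounded_op) : S = T <-> forall x, S x = T x.
Proof. by split=> [->//|ST]; apply/val_inj/funext. Qed.

Lemma bounded_op_gt0 (T : bounded_op) :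
  exists2 M : K, 0 < M & forall x, `|T x| <= M * `|x|.
Proof.
have [_ [M TM]] := bounded_opP T.
exists (`|M| + 1) => [|x]; first by rewrite ltr_wpDl.
have [->|x0] := eqVneq x 0.
  by have := TM 0; rewrite normr0 !mulr0.
apply: le_trans (TM x) _; have : 0 <= M * `|x| by apply: le_trans (TM x).
rewrite pmulr_lge0 ?normr_gt0// => M0.
by rewrite ler_wpM2r// ger0_norm// lerDl.
Qed.

Lemma id_bounded : (id : V -> V) \in bounded_linear.
Proof. by rewrite inE; split=> //; exists 1 => x; rewrite mul1r. Qed.

Lemma comp_bounded (S T : bounded_op) : (S \o T : V -> V) \in bounded_linear.
Proof.
have [lS _] := bounded_opP S; have [lT _] := bounded_opP T.
have [M M0 SM] := bounded_op_gt0 S; have [N N0 TN] := bounded_op_gt0 T.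
rewrite inE; split=> [k x y|]; first by rewrite /= lT lS.
exists (M * N) => x /=; apply: le_trans (SM _) _.
by rewrite -mulrA ler_wpM2l// ltW.
Qed.

Definition id_op := BoundedOp id_bounded.
Definition comp_op (S T : bounded_op) := BoundedOp (comp_bounded S T).

Lemma comp_opA : associative comp_op.
Proof. by move=> S T U; apply/bounded_op_eqP. Qed.

Lemma comp_1op : left_id id_op comp_op.
Proof. by move=> S; apply/bounded_op_eqP. Qed.

Lemma comp_op1 : right_id id_op comp_op.
Proof. by move=> S; apply/bounded_op_eqP. Qed.

Lemma comp_opDl : left_distributive comp_op +%R.
Proof. by move=> S T U; apply/bounded_op_eqP. Qed.

Lemma bounded_opD (T : bounded_op) x y : T (x + y) = T x + T y.
Proof. by have [lT _] := bounded_opP T; rewrite -[x]scale1r lT !scale1r. Qed.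

Lemma bounded_op0 (T : bounded_op) : T 0 = 0.
Proof. by apply: (addrI (T 0)); rewrite -bounded_opD !addr0. Qed.

Lemma bounded_opZ (T : bounded_op) k x : T (k *: x) = k *: T x.
Proof.
by have [lT _] := bounded_opP T; rewrite -[k *: x]addr0 lT bounded_op0 addr0.
Qed.

Lemma comp_opDr : right_distributive comp_op +%R.
Proof. by move=> S T U; apply/bounded_op_eqP => x; exact: bounded_opD. Qed.

HB.instance Definition _ := GRing.Zmodule_isPzRing.Build bounded_op
  comp_opA comp_1op comp_op1 comp_opDl comp_opDr.

Lemma bounded_op_continuous (T : bounded_op) : continuous T.
Proof.
have [M M0 TM] := bounded_op_gt0 T => x.
apply/(@cvgrPdist_lt _ _ _ (nbhs x)) => e e0; near=> z.
have -> : T x - T z = T (x - z).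
  by rewrite bounded_opD -[- z]scaleN1r bounded_opZ scaleN1r.
apply: le_lt_trans (TM _) _; rewrite -ltr_pdivlMl//.
by near: z; apply: cvgr_dist_lt => //; rewrite mulr_gt0 ?invr_gt0.
Unshelve. all: by end_near. Qed.

Definition compact_op : {pred bounded_op} :=
  mem [set T : bounded_op | precompact (T @` [set x | `|x| <= 1])].

Lemma compact_image_precompact (W : topologicalType) (f : W -> V)
    (A : set W) (B : set V) :
  continuous f -> compact A -> B `<=` f @` A -> precompact B.
Proof.
move=> cf cA BA; apply: precompact_subset BA _.
apply: compact_precompact; first exact: norm_hausdorff.
by apply: continuous_compact => //; exact: continuous_subspaceT.
Qed.

Lemma compact_op_zmod_closed : zmod_closed compact_op.
Proof.
split=> [|S T].
  rewrite inE /=; apply: (@precompact_subset _ _ [set 0]).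
    by move=> _ [x _ <-].
  apply: compact_precompact; first exact: norm_hausdorff.
  exact: compact_set1.
rewrite !inE /= !precompactE => cS cT.
set A := closure _ in cS; set B := closure _ in cT.
rewrite -precompactE.
apply: (@compact_image_precompact _ (fun z : V * V => z.1 - z.2) (A `*` B)).
- move=> z; apply: (@continuousB _ _ _ fst snd); first exact: cvg_fst.
  exact: cvg_snd.
- exact: compact_setX.
- move=> _ [x x1 <-]; exists (S x, T x) => //.
  by split; apply: subset_closure; exists x.
Qed.

HB.instance Definition _ := GRing.isZmodClosed.Build bounded_op compact_op
  compact_op_zmod_closed.

Lemma compact_opMl (S T : bounded_op) :
  T \in compact_op -> S * T \in compact_op.
Proof.
rewrite !inE /= precompactE => cT.
apply: (compact_image_precompact (@bounded_op_continuous S) cT).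
by move=> _ [x x1 <-]; exists (T x) => //; apply: subset_closure; exists x.
Qed.

Lemma compact_opMr (S T : bounded_op) :
  S \in compact_op -> S * T \in compact_op.
Proof.
rewrite !inE /= precompactE => cS; have [M M0 TM] := bounded_op_gt0 T.
apply: (compact_image_precompact (@scaler_continuous _ V M) cS).
move=> _ [x x1 <-]; exists (S (M^-1 *: T x)).
  apply: subset_closure; exists (M^-1 *: T x) => //=.
  rewrite normrZ gtr0_norm ?invr_gt0// ler_pdivrMl// mulr1.
  by apply: le_trans (TM x) _; rewrite -[leRHS]mulr1 ler_wpM2l// ltW.
by rewrite bounded_opZ scalerA divff ?gt_eqF// scale1r.
Qed.

Definition calkin := Quotient.quot compact_op.

HB.instance Definition _ := GRing.Zmodule.on calkin.
HB.instance Definition _ : EqQuotient bounded_op (Quotient.equiv compact_op) calkin :=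
  EqQuotient.on calkin.

Lemma calkin_eqP (S T : bounded_op) :
  \pi_calkin S = \pi_calkin T <-> S - T \in compact_op.
Proof. by rewrite Quotient.idealrBE; split=> [->//|/eqP]. Qed.

Lemma calkin_classP (a : calkin) : exists S : bounded_op, a = \pi_calkin S.
Proof. by exists (repr a); rewrite reprK. Qed.

Definition calkin_one : calkin := \pi_calkin 1.
Definition calkin_mul (a b : calkin) : calkin := \pi_calkin (repr a * repr b).

Lemma pi_calkinM (S T : bounded_op) :
  calkin_mul (\pi_calkin S) (\pi_calkin T) = \pi_calkin (S * T).
Proof.
apply/calkin_eqP; set S' := repr _; set T' := repr _.
have cS : S' - S \in compact_op by apply/calkin_eqP; rewrite reprK.
have cT : T' - T \in compact_op by apply/calkin_eqP; rewrite reprK.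
have -> : S' * T' - S * T = (S' - S) * T' + S * (T' - T).
  by rewrite mulrBl mulrBr addrA subrK.
by apply: rpredD; [exact: compact_opMr|exact: compact_opMl].
Qed.

Lemma pi_calkinD (S T : bounded_op) :
  \pi_calkin S + \pi_calkin T = \pi_calkin (S + T).
Proof. by apply: esym; exact: Quotient.pi_add. Qed.

Lemma calkin_mulA : associative calkin_mul.
Proof.
move=> a b c; have [S ->] := calkin_classP a.
have [T ->] := calkin_classP b; have [U ->] := calkin_classP c.
by rewrite !pi_calkinM mulrA.
Qed.

Lemma calkin_mul1l : left_id calkin_one calkin_mul.
Proof. by move=> a; have [S ->] := calkin_classP a; rewrite pi_calkinM mul1r. Qed.

Lemma calkin_mul1r : right_id calkin_one calkin_mul.
Proof. by move=> a; have [S ->] := calkin_classP a; rewrite pi_calkinM mulr1. Qed.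

Lemma calkin_mulDl : left_distributive calkin_mul +%R.
Proof.
move=> a b c; have [S ->] := calkin_classP a.
have [T ->] := calkin_classP b; have [U ->] := calkin_classP c.
by rewrite pi_calkinD !pi_calkinM pi_calkinD mulrDl.
Qed.

Lemma calkin_mulDr : right_distributive calkin_mul +%R.
Proof.
move=> a b c; have [S ->] := calkin_classP a.
have [T ->] := calkin_classP b; have [U ->] := calkin_classP c.
by rewrite pi_calkinD !pi_calkinM pi_calkinD mulrDr.
Qed.

HB.instance Definition _ := GRing.Zmodule_isPzRing.Build calkin
  calkin_mulA calkin_mul1l calkin_mul1r calkin_mulDl calkin_mulDr.

Definition essential_spectrum (T : bounded_op) : set K :=
  [set z | ~ invertible (\pi_calkin T - \pi_calkin (z *: id_op) : calkin)].

End BoundedOperators.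

Definition separable (X : topologicalType) :=
  exists2 D : set X, countable D & dense D.

Definition linear_span (K : numFieldType) (V : lmodType K) (A : set V) : set V :=
  [set x | exists (n : nat) (c : 'I_n -> K) (a : 'I_n -> V),
     (forall i, A (a i)) /\ x = \sum_i c i *: a i].

Definition infinite_dimensional (K : numFieldType) (V : lmodType K) :=
  forall A : set V, finite_set A -> linear_span A <> setT.

(* The inner product is linear in its first variable and conjugate-linear in
   the second one. *)
HB.mixin Record isHilbert (R : realType) H of CompleteNormedModule R[i] H := {
  inner : {dot H for (@Num.conj R[i])};
  sqr_norm_inner : forall x : H, `|x| ^+ 2 = inner x x
}.

#[short(type="hilbertType")]
HB.structure Definition Hilbert (R : realType) :=
  {H of isHilbert R H & CompleteNormedModule R[i] H}.

Definition orthonormal_basis (R : realType) (H : hilbertType R) (u : nat -> H) :=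
  (forall i j, inner (u i) (u j) = (i == j)%:R) /\
  closure (linear_span (range u)) = setT.

Definition diagonal : set (nat * nat) := [set p | p.1 = p.2].

(* Indices start at 0: the positive integer j is encoded as j - 1, which only
   relabels the pairs, as admissibility depends on the order of the indices
   alone; "j = 1, ..., m" becomes "j <= m". *)
Definition admissible (B : set (nat * nat)) :=
  B `<=` ~` diagonal /\
  forall m, exists2 n, (m < n)%N &
    forall j, (j <= m)%N -> ~ B (j, n) /\ ~ B (n, j).

Definition unit_circle (R : realType) : set R[i] := [set z | `|z| = 1].

(* Main.v *)
(** If z is in the essential spectrum of T, then T - z or its adjoint has
    approximate unit eigenvectors v orthogonal to any given finite set, so
    <T^l v, v> is close to z^l for all |l| <= k, negative l included.  Spread over
    roots of unity on the two circles, the vectors (z^l, conj z^l) with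
    0 < |l| <= k span, and their mean is 0; hence 0 is interior to their convex
    hull, and this survives small perturbations.  Taking sqrt-weighted sums of
    approximate eigenvectors that are orthogonal to each other's images, one gets
    some d > 0 such that every family (lam_l) with |lam_l| <= d is exactly
    (<T^l v, v>) for a unit vector v orthogonal to any given finite set.  The
    basis is then built inductively.  At an index given by admissibility the new
    vector has a component of fixed relative size along the residual of a vector
    of a dense sequence, so this residual decreases geometrically; all the other
    vectors are generic. *)

Require Import Defs.
From mathcomp Require Import all_boot all_order all_algebra.
From mathcomp Require Import cyclic.
From mathcomp Require separable cyclotomic.
From mathcomp Require Import sesquilinear ring_quotient ring zify.
From mathcomp Require Import all_classical all_reals all_analysis.

Set Implicit Arguments.
Unset Strict Implicit.
Unset Printing Implicit Defensive.

Import Order.TTheory GRing.Theory Num.Theory.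
Import numFieldNormedType.Exports.
Local Open Scope classical_set_scope.
Local Open Scope ring_scope.
Local Open Scope quotient_scope.

(** * Perturbed linear systems *)

Section PerturbedSystems.
Variable K : numFieldType.

Definition l1norm m n (A : 'M[K]_(m, n)) := \sum_i \sum_j `|A i j|.

Lemma l1norm_ge0 m n (A : 'M[K]_(m, n)) : 0 <= l1norm A.
Proof. by apply: sumr_ge0 => i _; apply: sumr_ge0. Qed.

Lemma l1normD m n (A B : 'M[K]_(m, n)) : l1norm (A + B) <= l1norm A + l1norm B.
Proof.
rewrite -big_split; apply: ler_sum => i _; rewrite -big_split; apply: ler_sum => j _.
by rewrite mxE ler_normD.
Qed.

Lemma l1normN m n (A : 'M[K]_(m, n)) : l1norm (- A) = l1norm A.
Proof. by apply: eq_bigr => i _; apply: eq_bigr => j _; rewrite mxE normrN. Qed.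

Lemma le_l1norm m n (A : 'M[K]_(m, n)) i j : `|A i j| <= l1norm A.
Proof.
rewrite /l1norm (bigD1 i)//= (bigD1 j)//= -addrA lerDl addr_ge0//.
  by apply: sumr_ge0.
by apply: sumr_ge0 => k _; apply: sumr_ge0.
Qed.

Lemma l1norm_eq0 m n (A : 'M[K]_(m, n)) : l1norm A <= 0 -> A = 0.
Proof.
move=> A0; apply/matrixP => i j; rewrite mxE; apply/normr0_eq0/eqP.
by rewrite eq_le normr_ge0 andbT (le_trans (le_l1norm _ _ _)).
Qed.

Lemma l1normM m n k (A : 'M[K]_(m, n)) (B : 'M[K]_(n, k)) :
  l1norm (A *m B) <= l1norm A * l1norm B.
Proof.
rewrite mulr_suml; apply: ler_sum => i _.
apply: (@le_trans _ _ (\sum_j \sum_l `|A i l| * `|B l j|)).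
  apply: ler_sum => j _; rewrite mxE; apply: le_trans (ler_norm_sum _ _ _) _.
  by apply: ler_sum => l _; rewrite normrM.
rewrite exchange_big mulr_suml; apply: ler_sum => l _; rewrite -mulr_sumr.
rewrite ler_wpM2l// /l1norm [leRHS](bigD1 l)//= lerDl.
by apply: sumr_ge0 => i' _; apply: sumr_ge0.
Qed.

Lemma l1norm_le m n (A : 'M[K]_(m, n)) d : (forall i j, `|A i j| <= d) ->
  l1norm A <= d * (m * n)%:R.
Proof.
move=> Ad; apply: (@le_trans _ _ (\sum_(i < m) \sum_(j < n) d)).
  by apply: ler_sum => i _; apply: ler_sum => j _.
by rewrite !sumr_const !card_ord -mulrnA mulr_natr mulnC.
Qed.

Lemma half_le0 (x : K) : 0 <= x -> x <= x / 2 -> x <= 0.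
Proof.
by move=> x0; rewrite ler_pdivlMr// mulr_natr mulr2n gerDl.
Qed.

(** A kernel vector satisfies [v = - (v *m E)], so its norm is at most half of itself. The same
    absorption in [y = b - E *m y] gives the factor 2. *)
Lemma solve_near_id m (E : 'M[K]_m) (b : 'cV[K]_m) : l1norm E <= 2^-1 ->
  exists2 y : 'cV[K]_m, (1%:M + E) *m y = b & l1norm y <= 2 * l1norm b.
Proof.
move=> E2.
have u : 1%:M + E \in unitmx.
  rewrite unitmxE unitfE; apply/det0P => -[v /eqP v0]; rewrite mulmxDr mulmx1 => /eqP.
  rewrite addr_eq0 => /eqP vE; apply: v0.
  apply/l1norm_eq0/half_le0; first exact: l1norm_ge0.
  rewrite {1}vE l1normN; apply: le_trans (l1normM _ _) _.
  by rewrite ler_wpM2l ?l1norm_ge0.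
exists (invmx (1%:M + E) *m b); first by rewrite mulmxA mulmxV// mul1mx.
set y := _ *m b.
have yE : y = b - E *m y.
  apply/eqP; rewrite eq_sym subr_eq; apply/eqP.
  by rewrite -[X in _ = X + _]mul1mx -mulmxDl mulmxA mulmxV// mul1mx.
have : l1norm y <= l1norm b + l1norm y / 2.
  rewrite {1}yE; apply: le_trans (l1normD _ _) _; rewrite lerD2l l1normN.
  by apply: le_trans (l1normM _ _) _; rewrite mulrC ler_wpM2l ?l1norm_ge0.
by rewrite -lerBlDr [X in X - _]splitr addrK ler_pdivrMr// mulrC.
Qed.

(** With [L] a right inverse of [p], the ansatz [w = w0 + L *m y] leads to
    [(1 + (P - p) *m L) *m y = t - P *m w0], a perturbation of the identity. What matters later is
    that [d] is uniform in [P] and [t] and that the solution stays close to [w0]. *)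
Lemma perturbed_system m n (p : 'M[K]_(m, n)) (w0 : 'cV[K]_n) (e : K) :
  row_free p -> 0 < e ->
  exists2 d : K, 0 < d & forall (P : 'M[K]_(m, n)) (t : 'cV[K]_m),
    (forall i j, `|P i j - p i j| <= d) -> (forall i, `|t i 0 - (p *m w0) i 0| <= d) ->
    exists2 w : 'cV[K]_n, P *m w = t & forall j, `|w j 0 - w0 j 0| <= e.
Proof.
move=> /row_freeP[L pL] e0.
(* [d * c] will bound both [2 * l1norm ((P - p) *m L)] and [l1norm L * l1norm y]. *)
pose c : K := (m * n + m).+1%:R * (l1norm L + 1) * (l1norm w0 + 1) * 2.
have L0 := l1norm_ge0 L; have w00 := l1norm_ge0 w0.
have L1 : 0 < l1norm L + 1 by rewrite ltr_wpDl.
have w1 : 0 < l1norm w0 + 1 by rewrite ltr_wpDl.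
have c0 : 0 < c by rewrite !mulr_gt0// ltr0n.
(* The factor [e / (1 + e)] stands in for a minimum: it is at most 1 and at most [e]. *)
pose d := e / (1 + e) / c.
have e1 : 0 < 1 + e by rewrite addr_gt0.
have d0 : 0 < d by rewrite !divr_gt0.
have dc : d * c = e / (1 + e) by rewrite divfK// gt_eqF.
have dc1 : d * c <= 1 by rewrite dc ler_pdivrMr// mul1r lerDr.
have dce : d * c <= e by rewrite dc ler_pdivrMr// mulrDr mulr1 lerDl mulr_ge0// ltW.
exists d => // P t Pp tp.
have nD : l1norm (P - p) <= d * (m * n)%:R by apply: l1norm_le => i j; rewrite !mxE.
have nt : l1norm (t - p *m w0) <= d * m%:R.
  rewrite -[m in leRHS]muln1; apply: l1norm_le => i j.
  by have := tp i; rewrite ord1 !mxE.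
have mn1 : (m * n)%:R <= (m * n + m).+1%:R :> K by rewrite ler_nat leqW// leq_addr.
have nE : l1norm ((P - p) *m L) <= 2^-1.
  apply: le_trans (l1normM _ _) _; rewrite -(@ler_pM2r _ 2)// mulVf ?pnatr_eq0//.
  apply: le_trans dc1; apply: (@le_trans _ _ (d * (m * n)%:R * l1norm L * 2)).
    by rewrite ler_wpM2r// ler_wpM2r.
  rewrite /c !mulrA ler_wpM2r//.
  apply: (@le_trans _ _ (d * (m * n + m).+1%:R * (l1norm L + 1))).
    have dN : d * (m * n)%:R <= d * (m * n + m).+1%:R by rewrite ler_wpM2l// ltW.
    apply: ler_pM => //; last by rewrite lerDl.
    by rewrite mulr_ge0// ltW.
  rewrite ler_peMr ?lerDr//; apply: mulr_ge0; last exact: ltW.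
  by rewrite mulr_ge0// ltW.
have [y yE yb] := solve_near_id (t - P *m w0) nE.
exists (w0 + L *m y).
  have PLy : P *m (L *m y) = t - P *m w0.
    by rewrite -yE mulmxA mulmxBl pL (addrC 1%:M) subrK.
  by rewrite mulmxDr PLy addrC subrK.
move=> j; rewrite mxE addrAC subrr add0r; apply: le_trans (le_l1norm _ _ _) _.
apply: le_trans (l1normM _ _) _; apply: le_trans dce.
have nb : l1norm (t - P *m w0) <= d * ((m * n + m).+1%:R * (l1norm w0 + 1)).
  have -> : t - P *m w0 = (t - p *m w0) - (P - p) *m w0.
    by rewrite mulmxBl opprB addrA subrK.
  apply: le_trans (l1normD _ _) _; rewrite l1normN.
  apply: (@le_trans _ _ (d * m%:R + d * (m * n)%:R * l1norm w0)).
    by rewrite lerD//; apply: le_trans (l1normM _ _) _; rewrite ler_wpM2r.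
  rewrite -mulrA -mulrDr ler_wpM2l ?(ltW d0)// mulrDr mulr1 addrC.
  by rewrite lerD ?ler_wpM2r// ler_nat leqW// leq_addl.
apply: (@le_trans _ _ ((l1norm L + 1) *
    (2 * (d * ((m * n + m).+1%:R * (l1norm w0 + 1)))))).
  rewrite ler_pM ?l1norm_ge0// ?lerDl//; apply: le_trans yb _.
  by rewrite ler_wpM2l.
by rewrite le_eqVlt; apply/orP; left; apply/eqP; rewrite /c; ring.
Qed.

End PerturbedSystems.

(** * Moments of two circles *)

Lemma sum_pair (V : nmodType) (I J : finType) (F : I * J -> V) :
  \sum_x F x = \sum_i \sum_j F (i, j).
Proof. by rewrite pair_bigA; apply: eq_bigr => -[]. Qed.

Lemma sum_enum_val (V : nmodType) (I : finType) (F : I -> V) :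
  \sum_(i < #|I|) F (enum_val i) = \sum_x F x.
Proof. by exact/esym/(big_enum_val (A := I)). Qed.

Section TwoCircles.
Variable C : numClosedFieldType.

(** In characteristic 0 the polynomial [X^n - 1] is separable, and a list of n distinct n-th roots
    of unity contains a primitive one. *)
Lemma exists_prim_root n : (0 < n)%N -> exists z : C, n.-primitive_root z.
Proof.
move=> n0; have [rs rsE] := closed_field_poly_normal ('X^n - 1 : {poly C}).
rewrite (monicP (monicXnsubC 1 n0)) scale1r in rsE.
have rs1 : all n.-unity_root rs by apply/allP => z; rewrite -root_prod_XsubC -rsE.
have rs_uniq : uniq rs.
  by rewrite -separable.separable_prod_XsubC -rsE cyclotomic.separable_Xn_sub_1//
    pnatr_eq0 -lt0n.
have rs_size : (n <= size rs)%N.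
  by rewrite -ltnS -(size_prod_XsubC rs id) -rsE size_XnsubC.
by have /hasP[z _ pz] := has_prim_root n0 rs1 rs_uniq rs_size; exists z.
Qed.

Lemma prim_root_norm n (w : C) : n.-primitive_root w -> `|w| = 1.
Proof.
move=> pw; apply/eqP; rewrite -(@pexpr_eq1 _ _ n) ?(prim_order_gt0 pw)//.
by rewrite -normrX (prim_expr_order pw) normr1.
Qed.

(** A polynomial of size at most n with the n distinct roots [w ^+ j] vanishes. *)
Lemma fourier_coef_eq0 n (w : C) (c : nat -> C) : n.-primitive_root w ->
  (forall j, (j < n)%N -> \sum_(m < n) c m * (w ^+ j) ^+ m = 0) ->
  forall m, (m < n)%N -> c m = 0.
Proof.
move=> pw cj m mn; have := coef_poly n c m; rewrite mn => <-.
suff -> : \poly_(i < n) c i = 0 by rewrite coef0.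
apply: (@roots_geq_poly_eq0 _ _ [seq w ^+ j | j <- iota 0 n]).
- apply/allP => _ /mapP[j + ->]; rewrite mem_iota /= => jn.
  by rewrite /root horner_poly; apply/eqP/cj.
- rewrite map_inj_in_uniq ?iota_uniq// => i j; rewrite !mem_iota /= => iN jN /eqP.
  by rewrite (eq_prim_root_expr pw) !modn_small// => /eqP.
- by rewrite size_map size_iota size_poly.
Qed.

Variables (k : nat) (w r s : C).
Let n := k.*2.+1.
Hypotheses (pw : n.-primitive_root w) (r0 : 0 < r) (rs : r < s).

Definition circle_radius (b : bool) := if b then s else r.

Definition circle_point (q : bool * 'I_n) := circle_radius q.1 * w ^+ q.2.

(** The exponents run from -k to k. Index k carries the exponent 0, whose moment is a squared norm;
    it is treated apart throughout. *)
Definition exponent (m : 'I_n) : int := m%:Z - k%:Z.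

(* The trivial relation for the exponent 0 in the conjugate family is replaced by
   the radius, so that all the rows are linearly independent. *)
Definition moment_row (x : 'I_n * bool) (q : bool * 'I_n) : C :=
  if x.2 then if x.1 == k :> nat then circle_radius q.1
              else (circle_point q ^ exponent x.1)^*
  else circle_point q ^ exponent x.1.

Lemma circle_radius_gt0 b : 0 < circle_radius b.
Proof. by case: b => //; exact: lt_trans rs. Qed.

Lemma norm_circle_point q : `|circle_point q| = circle_radius q.1.
Proof.
rewrite normrM normrX (prim_root_norm pw) expr1n mulr1.
by rewrite gtr0_norm ?circle_radius_gt0.
Qed.

Lemma k_lt_n : (k < n)%N.
Proof. by rewrite /n ltnS -addnn leq_addr. Qed.

Lemma rev_exponent m : exponent (rev_ord m) = - exponent m.
Proof.
rewrite /exponent /= /n; have := ltn_ord m; rewrite /n.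
lia.
Qed.

Lemma rev_ord_eqk (m : 'I_n) : (rev_ord m == k :> nat) = (m == k :> nat).
Proof. by apply/eqP/eqP => /=; have := ltn_ord m; rewrite /n; lia. Qed.

Lemma w_neq0 : w != 0. Proof. by rewrite (prim_root_eq0 pw). Qed.

Lemma conj_w : w^* = w^-1.
Proof. by rewrite invC_norm (prim_root_norm pw) expr1n invr1 mul1r. Qed.

Lemma conj_circle_point b (j : 'I_n) (l : int) :
  (circle_point (b, j) ^ l)^* = circle_radius b ^ l * (w ^+ j) ^ (- l).
Proof.
have rb : circle_radius b != 0 by rewrite gt_eqF ?circle_radius_gt0.
have wj : w ^+ j != 0 by rewrite expf_neq0// w_neq0.
rewrite rmorphXz ?unitfE ?mulf_neq0//= rmorphM/= rmorphXn/= conj_w exprVn.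
by rewrite expfzMl exprz_inv (CrealP _)// gtr0_real ?circle_radius_gt0.
Qed.

Lemma exprz_inj2 (x y : C) (l : int) :
  l != 0 -> 0 < x -> 0 < y -> x ^ l = y ^ l -> x = y.
Proof.
move=> l0 x0 y0; case: l l0 => [[|m]|m] // _.
  by move/eqP; rewrite eqrXn2 ?ltW// => /eqP.
by move/invr_inj/eqP; rewrite eqrXn2 ?ltW// => /eqP.
Qed.

(* On the circle of radius rho, conj (z ^ l) = rho ^ (2 l) z ^ (- l): a vanishing
   combination is a Laurent polynomial in the roots of unity with two
   coefficients for each exponent, which the two radii separate. *)
Lemma moment_row_free (a : 'I_n * bool -> C) :
  (forall q, \sum_x a x * moment_row x q = 0) -> forall x, a x = 0.
Proof.
move=> aq.
(* [c rho m] collects the coefficient of [(w ^+ j) ^ (m - k)] on the circle of radius [rho];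
   conjugation reverses exponents, hence [rev_ord]. *)
pose c rho (m : nat) : C := if insub m is Some i then
  a (i, false) * rho ^ exponent i +
  (if m == k then a (i, true) * rho
   else a (rev_ord i, true) * rho ^ (- exponent i)) else 0.
have cE b m : (m < n)%N -> c (circle_radius b) m = 0.
  move: m; apply: (fourier_coef_eq0 pw) => j jn.
  have rb0 : circle_radius b != 0 by rewrite gt_eqF ?circle_radius_gt0.
  have wj : w ^+ j != 0 by rewrite expf_neq0// w_neq0.
  (* Multiplying by [(w ^+ j) ^+ k] clears the negative exponents, so that [fourier_coef_eq0]
     applies. *)
  have := congr1 (fun x => (w ^+ j) ^+ k * x) (aq (b, Ordinal jn)).
  rewrite mulr0 sum_pair.
  under [X in _ * X = _ -> _]eq_bigr do rewrite big_bool.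
  rewrite big_split/= (reindex_inj rev_ord_inj)/= -big_split/= mulr_sumr => e0.
  rewrite -[RHS]e0.
  apply: eq_bigr => i _; rewrite /c valK.
  rewrite /moment_row /= -/(rev_ord i) rev_ord_eqk conj_circle_point rev_exponent opprK.
  have zE : (w ^+ j) ^+ i = (w ^+ j) ^+ k * (w ^+ j) ^ exponent i.
    by rewrite !exprnP -expfzDr// /exponent addrC subrK.
  rewrite zE /circle_point/= expfzMl.
  case: ifP => ik; last by ring.
  have -> : rev_ord i = i by apply/val_inj/eqP => /=; rewrite (eqP ik) /n; lia.
  by rewrite /exponent (eqP ik) subrr !expr0z; ring.
have key (m : 'I_n) : m != k :> nat -> a (m, false) = 0 /\ a (rev_ord m, true) = 0.
  move=> mk; have l0 : exponent m != 0 by rewrite subr_eq0.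
  have := cE true m (ltn_ord m); have := cE false m (ltn_ord m).
  rewrite /c valK (negbTE mk) /= => c1 c2.
  (* Used for both radii: unless [a (m, false)] vanishes, [r ^+ 2] and [s ^+ 2] have the same power
     of nonzero exponent, contradicting [r < s]. *)
  have solve x : 0 < x ->
      a (m, false) * x ^ exponent m + a (rev_ord m, true) * x ^ (- exponent m) = 0 ->
      a (rev_ord m, true) = - (a (m, false) * (x ^+ 2) ^ exponent m).
    move=> x0 e; have x1 : x != 0 by rewrite gt_eqF.
    apply/eqP; rewrite -addr_eq0 addrC; apply/eqP.
    apply: (mulIf (expfz_neq0 (- exponent m) x1)); rewrite mul0r -[RHS]e mulrDl.
    by rewrite -mulrA expr2 expfzMl -mulrA -expfzDr// subrr expr0z mulr1.
  have e1 := solve _ r0 c1; have e2 := solve _ (circle_radius_gt0 true) c2.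
  have am : a (m, false) = 0.
    apply/eqP; apply: contraTT rs => am.
    have : r ^+ 2 = s ^+ 2.
      apply: (exprz_inj2 l0); rewrite ?exprn_gt0 ?(circle_radius_gt0 true)//.
      by apply: (mulfI am); apply: oppr_inj; rewrite -e1 e2.
    move/eqP; rewrite eqrXn2 ?(ltW r0) ?(ltW (circle_radius_gt0 true))//.
    by move/eqP->; rewrite ltxx.
  by split=> //; rewrite e1 am mul0r oppr0.
move=> [m b]; have [mk|mk] := eqVneq (m : nat) k.
  have := cE true m (ltn_ord m); have := cE false m (ltn_ord m).
  rewrite /c valK mk eqxx /= /exponent mk subrr !expr0z !mulr1 => c1 c2.
  have at0 : a (m, true) = 0.
    apply: (mulIf (_ : s - r != 0)); first by rewrite subr_eq0 gt_eqF.
    by rewrite mul0r -[RHS](subrr 0) -{1}c2 -c1; ring.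
  by case: b => //; move: c1; rewrite at0 mul0r addr0.
case: b; last by case: (key m mk).
by have [|_] := key (rev_ord m); rewrite ?rev_ord_eqk// rev_ordK.
Qed.

(** On each circle this is a full geometric sum whose ratio [w ^ exponent m] is an n-th root of
    unity other than 1. *)
Lemma moment_mean (m : 'I_n) : m != k :> nat ->
  \sum_q circle_point q ^ exponent m = 0.
Proof.
move=> mk; rewrite sum_pair.
apply: big1 => b _; have rb : circle_radius b != 0 by rewrite gt_eqF ?circle_radius_gt0.
under eq_bigr do rewrite /circle_point/= expfzMl exprnP exprzAC -exprnP.
rewrite -mulr_sumr; set x := w ^ exponent m.
have x1 : x != 1.
  rewrite /x expfzDr ?w_neq0// -invr_expz -!exprnP.
  rewrite -(inj_eq (mulIf (expf_neq0 k w_neq0))) divfK ?expf_neq0 ?w_neq0// mul1r.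
  by rewrite (eq_prim_root_expr pw) !modn_small// k_lt_n.
rewrite [X in _ * X](_ : _ = 0) ?mulr0//.
apply: (mulfI (_ : x - 1 != 0)); first by rewrite subr_eq0.
rewrite mulr0 -subrX1 /x exprnP exprzAC -exprnP (prim_expr_order pw).
by rewrite exp1rz subrr.
Qed.

(** Uniform weights solve the unperturbed system with moment 1 at exponent 0 and 0 elsewhere.
    [perturbed_system] yields a nearby complex solution; the conjugate rows make its conjugate a
    solution too, so its real part is one, and closeness to the uniform weights makes that
    nonnegative. *)
Lemma circle_weights : exists2 d : C, 0 < d &
  forall (P : 'I_n -> bool * 'I_n -> C) (lam : 'I_n -> C),
    (forall m q, `|P m q - circle_point q ^ exponent m| <= d) ->
    (forall (m : 'I_n) q, m == k :> nat -> P m q = 1) ->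
    (forall m : 'I_n, m == k :> nat -> lam m = 1) ->
    (forall m : 'I_n, m != k :> nat -> `|lam m| <= d) ->
  exists2 u : bool * 'I_n -> C, forall q, 0 <= u q &
    forall m : 'I_n, \sum_q P m q * u q = lam m.
Proof.
pose J : finType := ('I_n * bool)%type; pose Q : finType := (bool * 'I_n)%type.
pose p := \matrix_(i < #|J|, j < #|Q|) moment_row (enum_val i) (enum_val j).
have p_free : row_free p.
  apply: inj_row_free => v vp; apply/rowP => i; rewrite mxE -(enum_valK i).
  apply: (moment_row_free (a := fun x => v 0 (enum_rank x))) => q.
  have := congr1 (fun A : 'rV_#|Q| => A 0 (enum_rank q)) vp; rewrite !mxE => e1.
  rewrite -[RHS]e1 -[LHS]sum_enum_val; apply: eq_bigr => j _.
  by rewrite mxE !enum_valK !enum_rankK.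
(* [e] is both the uniform weight and the allowed deviation from it, which just keeps real parts
   nonnegative. *)
pose e : C := #|Q|%:R^-1.
have Q0 : #|Q|%:R != 0 :> C by rewrite pnatr_eq0 card_prod card_bool card_ord.
have e0 : 0 < e by rewrite invr_gt0 lt0r Q0 ler0n.
have er : e^* = e by apply/CrealP; exact: gtr0_real.
have [d d0 dP] := perturbed_system (const_mx e) p_free e0.
exists d => // P lam Pd Pk lk ld.
have mean (m : 'I_n) : m != k :> nat -> \sum_q circle_point q ^ exponent m * e = 0.
  by move=> mk; rewrite -mulr_suml moment_mean// mul0r.
have meank (m : 'I_n) : m == k :> nat ->
    \sum_(q : Q) circle_point q ^ exponent m * e = 1.
  move=> /eqP mk; rewrite /exponent mk subrr; under eq_bigr do rewrite expr0z mul1r.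
  by rewrite sumr_const -mulr_natl mulfV.
pose P' := \matrix_(i < #|J|, j < #|Q|) (let x := enum_val i in let q := enum_val j in
  if x.2 then (if x.1 == k :> nat then circle_radius q.1 else (P x.1 q)^*)
  else P x.1 q).
(* The auxiliary radius row keeps its unperturbed value as its target. *)
pose t := \col_(i < #|J|) (let x := enum_val i in
  if x.2 then
    if x.1 == k :> nat then (p *m const_mx e : 'cV_#|J|) i 0 else (lam x.1)^*
  else lam x.1).
have pe i : (p *m const_mx e : 'cV_#|J|) i 0 = \sum_q moment_row (enum_val i) q * e.
  by rewrite mxE -[RHS]sum_enum_val; apply: eq_bigr => j _; rewrite !mxE.
have [||u uE ue] := dP P' t.
- move=> i j; rewrite !mxE /=; case: (enum_val i) => m [] /=; rewrite /moment_row/=.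
    by case: ifP => _; rewrite ?subrr ?normr0 ?(ltW d0)// -rmorphB norm_conjC.
  exact: Pd.
- move=> i; rewrite pe mxE /= pe; case: (enum_val i) => m [] /=; rewrite /moment_row/=.
    case: ifP => mk; first by rewrite ?mk subrr normr0 ltW.
    have -> : \sum_q (circle_point q ^ exponent m)^* * e =
        (\sum_q circle_point q ^ exponent m * e)^*.
      rewrite rmorph_sum; apply: eq_bigr => q _.
      by rewrite rmorphM/= er.
    by rewrite mean ?mk// rmorph0 subr0 norm_conjC ld ?mk.
  have [mk|mk] := boolP (m == k :> nat); first by rewrite meank// lk// subrr normr0 ltW.
  by rewrite mean// subr0 ld.
pose W (q : Q) := u (enum_rank q) 0.
have row (x : J) : \sum_(q : Q) (if x.2 then (if x.1 == k :> nat then circle_radius q.1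
    else (P x.1 q)^*) else P x.1 q) * W q = t (enum_rank x) 0.
  rewrite -uE mxE -[LHS]sum_enum_val; apply: eq_bigr => j _.
  by rewrite mxE /= /W !enum_valK enum_rankK.
have rowP m : \sum_q P m q * W q = lam m.
  by have := row (m, false); rewrite /= mxE enum_rankK.
have rowPC m : \sum_q P m q * (W q)^* = lam m.
  have [mk|mk] := boolP (m == k :> nat).
    rewrite (lk _ mk) -[RHS](rmorph1 Num.conj) -(lk _ mk) -rowP rmorph_sum.
    by apply: eq_bigr => q _; rewrite Pk// !mul1r.
  have := row (m, true); rewrite /= mxE enum_rankK /= (negbTE mk) => e1.
  apply: (can_inj conjCK); rewrite -e1 rmorph_sum; apply: eq_bigr => q _.
  by rewrite rmorphM/= conjCK.
exists (fun q => (W q + (W q)^*) / 2) => [q|m]; last first.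
  transitivity (\sum_q (P m q * W q + P m q * (W q)^*) / 2).
    by apply: eq_bigr => q _; rewrite mulrA mulrDr.
  by rewrite -mulr_suml big_split/= rowP rowPC; field.
have := ue (enum_rank q); rewrite mxE -/(W q) => We.
have : `|(W q - e + (W q - e)^*) / 2| <= e.
  rewrite normrM normfV (ger0_norm (ler0n _ 2)) ler_pdivrMr// mulr_natr mulr2n.
  by apply: le_trans (ler_normD _ _) _; rewrite norm_conjC lerD.
have -> : (W q - e + (W q - e)^*) / 2 = (W q + (W q)^*) / 2 - e.
  by rewrite rmorphB/= er; field.
rewrite real_ler_norml; last first.
  rewrite rpredB ?(gtr0_real e0)// CrealE fmorph_div rmorphD/= conjCK.
  by rewrite rmorph_nat addrC.
by move=> /andP[+ _]; rewrite lerBrDr addNr.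
Qed.

End TwoCircles.

Local Open Scope complex_scope.

(** * Coercive forms and adjoints *)

Section InnerProduct.
Variables (R : realType) (H : hilbertType R).
Implicit Types (x y z : H) (c : R[i]).

Lemma innerC x y : inner x y = (inner y x)^*%R.
Proof. by rewrite hermC expr0 mul1r. Qed.

Lemma innerDl x y z : inner (x + y) z = inner x z + inner y z.
Proof. exact: linearDl. Qed.

Lemma innerDr x y z : inner x (y + z) = inner x y + inner x z.
Proof. exact: linearDr. Qed.

Lemma innerZl c x y : inner (c *: x) y = c * inner x y.
Proof. exact: linearZl_LR. Qed.

Lemma innerZr c x y : inner x (c *: y) = c^*%R * inner x y.
Proof. exact: linearZr_LR. Qed.

Lemma inner0l x : inner 0 x = 0.
Proof. exact: linear0l. Qed.

Lemma inner0r x : inner x 0 = 0.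
Proof. exact: linear0r. Qed.

Lemma innerBl x y z : inner (x - y) z = inner x z - inner y z.
Proof. exact: linearBl. Qed.

Lemma innerBr x y z : inner x (y - z) = inner x y - inner x z.
Proof. exact: linearBr. Qed.

Lemma inner_suml (I : Type) (r : seq I) (P : pred I) (f : I -> H) y :
  inner (\sum_(i <- r | P i) f i) y = \sum_(i <- r | P i) inner (f i) y.
Proof. exact: linear_sumlz. Qed.

Lemma inner_sumr (I : Type) (r : seq I) (P : pred I) (f : I -> H) y :
  inner y (\sum_(i <- r | P i) f i) = \sum_(i <- r | P i) inner y (f i).
Proof. exact: linear_sumr. Qed.

Lemma inner_eq0C x y : inner x y = 0 -> inner y x = 0.
Proof. by rewrite innerC => /eqP; rewrite fmorph_eq0 => /eqP. Qed.

Lemma pythagoras x y : inner x y = 0 -> `|x + y| ^+ 2 = `|x| ^+ 2 + `|y| ^+ 2.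
Proof. by rewrite !sqr_norm_inner; exact: hnormDd. Qed.

Lemma inner_inj x y : (forall z, inner z x = inner z y) -> x = y.
Proof.
move=> e; apply/subr0_eq/normr0_eq0/eqP; rewrite -sqrf_eq0 sqr_norm_inner.
by rewrite innerBr e subrr.
Qed.

Lemma Cauchy_Schwarz x y : `|inner x y| <= `|x| * `|y|.
Proof.
rewrite -(@ler_pXn2r _ 2)// ?nnegrE ?mulr_ge0//.
have [->|y0] := eqVneq y 0; first by rewrite inner0r !normr0 mulr0 expr0n.
have ny : 0 < `|y| ^+ 2 by rewrite exprn_gt0 ?normr_gt0.
set c := inner x y / `|y| ^+ 2.
have o : inner (x - c *: y) (c *: y) = 0.
  by rewrite innerZr innerBl innerZl -sqr_norm_inner divfK ?gt_eqF// subrr mulr0.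
rewrite exprMn; have := pythagoras o; rewrite subrK => ->.
rewrite mulrDl [X in _ + X](_ : _ = `|inner x y| ^+ 2).
  by rewrite lerDr mulr_ge0 ?exprn_ge0.
rewrite normrZ normrM normfV (ger0_norm (exprn_ge0 2 (normr_ge0 y))).
by field; rewrite normr_eq0.
Qed.

End InnerProduct.

Lemma natSinv_lt (R : realType) (e : R[i]) : 0 < e ->
  exists N, forall n, (N <= n)%N -> n.+1%:R^-1 < e.
Proof.
move=> e0; have er : e \is Num.real by rewrite gtr0_real.
have e0' : 0 < complex.Re e by rewrite -ltcR RRe_real.
have [N _ HN] := near_infty_natSinv_lt (PosNum e0').
exists N => n /HN /=; rewrite -ltcR RRe_real//; congr (_ < _).
by rewrite fmorphV rmorph_nat.
Qed.

Lemma hilbert_complete (R : realType) (H : hilbertType R) (x : nat -> H) :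
  (forall e : R[i], 0 < e -> exists N, forall n, (N <= n)%N -> `|x N - x n| < e) ->
  exists l, forall e : R[i], 0 < e -> exists N, forall n, (N <= n)%N -> `|l - x n| < e.
Proof.
move=> cx.
have /cauchy_cvg cv : cauchy (x @ \oo).
  apply: cauchy_exP => e e0; have [N HN] := cx e e0; exists (x N).
  by exists N => // n /= /HN; rewrite -ball_normE.
exists (lim (x @ \oo)) => e e0.
have /cvgrPdist_lt/(_ _ e0) [N _ HN] := cv.
by exists N => n /HN.
Qed.

Section CoerciveForms.
Variables (R : realType) (H : hilbertType R).
Implicit Types (x y z h : H).

(** The generality serves twice: [inner] itself yields adjoints, and a form built from an operator
    yields the inverse used in [left_parametrix]. *)
Definition coercive_form (a : H -> H -> R[i]) :=
  [/\ forall k x y z, a (k *: x + y) z = k * a x z + a y z,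
      forall x y, a x y = (a y x)^*%R,
      exists2 c : R[i], 0 < c & forall x, c * `|x| ^+ 2 <= a x x &
      exists2 M : R[i], 0 <= M & forall x y, `|a x y| <= M * (`|x| * `|y|)].

Variables (a : H -> H -> R[i]) (ca : coercive_form a).

Lemma cformDl x y z : a (x + y) z = a x z + a y z.
Proof. by case: ca => l _ _ _; rewrite -[x]scale1r l mul1r scale1r. Qed.

Lemma cform0l z : a 0 z = 0.
Proof. by apply: (addrI (a 0 z)); rewrite -cformDl !addr0. Qed.

Lemma cformZl k x z : a (k *: x) z = k * a x z.
Proof. by case: ca => l _ _ _; rewrite -[k *: x]addr0 l cform0l addr0. Qed.

Lemma cformC x y : a x y = (a y x)^*%R.
Proof. by case: ca. Qed.

Lemma cformDr x y z : a x (y + z) = a x y + a x z.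
Proof. by rewrite !(cformC x) cformDl rmorphD. Qed.

Lemma cformZr k x z : a x (k *: z) = k^*%R * a x z.
Proof. by rewrite !(cformC x) cformZl rmorphM. Qed.

Lemma form_ge0 x : 0 <= a x x.
Proof.
case: ca => _ _ [c c0 cc] _; apply: le_trans (cc x).
by rewrite mulr_ge0 ?exprn_ge0// ltW.
Qed.

Lemma cformBr x y z : a x (y - z) = a x y - a x z.
Proof. by rewrite cformDr -scaleN1r cformZr rmorphN1 mulN1r. Qed.

Lemma cformBl x y z : a (x - y) z = a x z - a y z.
Proof. by rewrite cformDl -scaleN1r cformZl mulN1r. Qed.

Lemma form_inj y z : (forall x, a x y = a x z) -> y = z.
Proof.
move=> e; apply/subr0_eq/normr0_eq0/eqP; rewrite -sqrf_eq0 eq_le exprn_ge0 ?andbT//.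
case: ca => _ _ [c c0 cc] _; have := cc (y - z).
by rewrite {1}cformBr e subrr pmulr_rle0.
Qed.

(** * Riesz representation by minimisation of the energy *)

Section Riesz.
Variables (phi : H -> R[i]) (N : R[i]).
Hypothesis phil : forall k x y, phi (k *: x + y) = k * phi x + phi y.
Hypothesis phib : forall x, `|phi x| <= N * `|x|.

Lemma phiD x y : phi (x + y) = phi x + phi y.
Proof. by rewrite -[x]scale1r phil mul1r scale1r. Qed.

Lemma phiZ k x : phi (k *: x) = k * phi x.
Proof.
have p0 : phi 0 = 0 by apply: (addrI (phi 0)); rewrite -phiD !addr0.
by rewrite -[k *: x]addr0 phil p0 addr0.
Qed.

(* The minimiser of the energy represents phi with respect to a. *)
Definition energy x := a x x - phi x - (phi x)^*%R.

Lemma conj_add_real (c : R[i]) : c + c^*%R \is Num.real.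
Proof. by rewrite CrealE rmorphD/= conjCK addrC. Qed.

Lemma energy_real x : energy x \is Num.real.
Proof.
by rewrite /energy -addrA -opprD rpredB ?conj_add_real// ger0_real ?form_ge0.
Qed.

(** Coercivity dominates the linear terms: [c t^2 - 2 |N| t] is minimal at [t = |N| / c]. *)
Lemma energy_bounded_below : exists m : R[i], m \is Num.real /\ forall x, m <= energy x.
Proof.
case: ca => _ _ [c c0 cc] _.
(* The bound [phib] shows [N] to be real only when [H] has a nonzero vector, hence the use of
   [|N|]. *)
have Nr : (exists x, x != 0) -> N \is Num.real.
  move=> [x x0]; have : 0 <= N * `|x| by apply: le_trans (phib x).
  by rewrite pmulr_lge0 ?normr_gt0// => /ger0_real.
exists (- (`|N| ^+ 2 / c)); split.
  by rewrite rpredN ger0_real// mulr_ge0 ?invr_ge0 ?exprn_ge0// ltW.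
move=> x; rewrite /energy -addrA -opprD lerBrDr addrC lerBlDr.
have le1 : phi x + (phi x)^*%R <= 2 * (`|N| * `|x|).
  apply: le_trans (real_ler_norm (conj_add_real _)) _.
  apply: le_trans (ler_normD _ _) _; rewrite norm_conjC -mulr2n mulr_natl ler_wMn2r//.
  apply: le_trans (phib _) _.
  have [->|x0] := eqVneq x 0; first by rewrite normr0 !mulr0.
  by rewrite ler_wpM2r// real_ler_norm// Nr//; exists x.
apply: (@le_trans _ _ (c * `|x| ^+ 2 + `|N| ^+ 2 / c)); last first.
  by rewrite lerD2r.
apply: le_trans le1 _; rewrite -subr_ge0.
have -> : c * `|x| ^+ 2 + `|N| ^+ 2 / c - 2 * (`|N| * `|x|) =
    c * (`|x| - `|N| / c) ^+ 2.
  by field; rewrite gt_eqF.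
rewrite mulr_ge0 ?real_exprn_even_ge0 ?(ltW c0)//.
by rewrite rpredB ?rpredM ?rpredV ?normr_real// gtr0_real.
Qed.

Lemma energy_inf : exists d : R[i],
  (forall x, d <= energy x) /\ forall e : R[i], 0 < e -> exists x, energy x < d + e.
Proof.
have [m [mr mE]] := energy_bounded_below.
(* The infimum is taken in [R], where order completeness is available; the energy is real. *)
pose E := [set complex.Re (energy x) | x in setT].
have hE : has_inf E.
  split; first by exists (complex.Re (energy 0)), 0.
  exists (complex.Re m) => _ [x _ <-].
  by rewrite -lecR !RRe_real ?energy_real.
exists (inf E)%:C; split=> [x|e e0].
  rewrite -(RRe_real (energy_real x)) lecR; apply: ge_inf; first by case: hE.
  by exists x.
have er := gtr0_real e0.
have e0' : 0 < complex.Re e by rewrite -ltcR RRe_real.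
have [_ [x _ <-]] := inf_adherent e0' hE.
rewrite -ltcR rmorphD/= !RRe_real ?energy_real// => ?; by exists x.
Qed.

Lemma energy_parallelogram x y : energy x + energy y - 2 * energy (2^-1 *: (x + y)) =
  2^-1 * a (x - y) (x - y).
Proof.
rewrite /energy !phiZ !phiD cformBr !cformBl !cformZl !cformZr !cformDl !cformDr.
by rewrite !rmorphM/= !rmorphD/= fmorphV/= rmorph_nat; field.
Qed.

Lemma energy_shift x h t : energy (x + t *: h) =
  energy x + t * (a h x - phi h) + (t * (a h x - phi h))^*%R + `|t| ^+ 2 * a h h.
Proof.
rewrite /energy !phiD !phiZ !cformDl !cformDr !cformZl !cformZr (cformC x h) normCK.
by rewrite !rmorphD/= !rmorphM/= rmorphB/=; ring.
Qed.

(** A minimising sequence is Cauchy by the parallelogram identity and coercivity, since midpoints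
    have energy at least [d]. Shifts along [h] bound [a h (x n) - phi h], and this bound passes to
    the limit [l]. *)
Lemma form_riesz : exists y, forall x, phi x = a x y.
Proof.
have [d [dE Ed]] := energy_inf.
have [x Hx] : {x : nat -> H & forall n, energy (x n) < d + n.+1%:R^-1}.
  apply: (@choice _ _ (fun n x => energy x < d + n.+1%:R^-1)) => n; apply: Ed.
  by rewrite invr_gt0 ltr0n.
have [l xl] : exists l, forall e : R[i], 0 < e ->
    exists N, forall n, (N <= n)%N -> `|l - x n| < e.
  apply: hilbert_complete => e e0.
  case: ca => _ _ [c c0 cc] _.
  have [n0 Hn0] : exists N, forall n, (N <= n)%N -> n.+1%:R^-1 < c * e ^+ 2 / 4.
    by apply: natSinv_lt; rewrite divr_gt0 ?mulr_gt0 ?exprn_gt0.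
  exists n0 => n n0n; rewrite -(@ltr_pXn2r _ 2)// ?nnegrE ?normr_ge0 ?(ltW e0)//.
  rewrite -(ltr_pM2l c0); apply: le_lt_trans (cc _) _.
  have -> : a (x n0 - x n) (x n0 - x n) =
    2 * (energy (x n0) + energy (x n) - 2 * energy (2^-1 *: (x n0 + x n))).
    by rewrite energy_parallelogram mulrA divff ?mul1r// pnatr_eq0.
  apply: (@lt_le_trans _ _ (2 * ((d + n0.+1%:R^-1) + (d + n.+1%:R^-1) - 2 * d))).
    rewrite ltr_pM2l ?ltr0n//; apply: ltr_leB.
      exact: ltrD (Hx _) (Hx _).
    by rewrite ler_pM2l ?ltr0n.
  have -> : 2 * (d + n0.+1%:R^-1 + (d + n.+1%:R^-1) - 2 * d) =
     2 * (n0.+1%:R^-1 + n.+1%:R^-1) by ring.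
  apply: (@le_trans _ _ (2 * (c * e ^+ 2 / 4 + c * e ^+ 2 / 4))).
    by rewrite ler_pM2l ?ltr0n// lerD// ltW// Hn0.
  by rewrite le_eqVlt; apply/orP; left; apply/eqP; field.
exists l => h; apply/esym/subr0_eq/normr0_eq0/eqP.
have [//|] := eqVneq `|a h l - phi h| 0.
rewrite -normr_gt0 normr_id => w0; exfalso.
(* The added 1 keeps [g] positive even for [h = 0]. *)
pose g := a h h + 1.
have g0 : 0 < g by rewrite ltr_wpDl ?form_ge0.
have gc : g^*%R = g by apply/CrealP/gtr0_real.
have key n : `|a h (x n) - phi h| ^+ 2 <= g * n.+1%:R^-1.
  set w := _ - _; set W := `|w| ^+ 2.
  have W0 : 0 <= W by rewrite exprn_ge0.
  (* This shift lowers the energy by at least [W / g], while [x n] lies within [1 / (n + 1)] of the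
     infimum. *)
  have := dE (x n + (- (g^-1 * w^*%R)) *: h); rewrite energy_shift -/w.
  have -> : - (g^-1 * w^*%R) * w = - (g^-1 * W) by rewrite /W normCK; ring.
  have -> : (- (g^-1 * W))^*%R = - (g^-1 * W).
    by apply/CrealP; rewrite rpredN ger0_real// mulr_ge0// invr_ge0 ltW.
  have -> : `|- (g^-1 * w^*%R)| ^+ 2 * a h h = g^-1 * W - g^-1 * (g^-1 * W).
    rewrite normrN normrM norm_conjC normfV gtr0_norm// exprMn -/W.
    have -> : a h h = g - 1 by rewrite addrK.
    by field; rewrite gt_eqF.
  move=> le1; have {le1} := le_lt_trans le1
    (_ : _ < (d + n.+1%:R^-1) - g^-1 * W - g^-1 * (g^-1 * W)).
  have -> : energy (x n) - g^-1 * W - g^-1 * W + (g^-1 * W - g^-1 * (g^-1 * W)) =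
    energy (x n) - g^-1 * W - g^-1 * (g^-1 * W) by ring.
  rewrite !ltrD2r => /(_ (Hx n)); rewrite -!addrA ltrDl -opprD subr_gt0 => lt1.
  rewrite mulrC -ler_pdivrMr// mulrC; apply: le_trans (ltW lt1).
  by rewrite lerDl !mulr_ge0 ?invr_ge0 ?(ltW g0).
case: ca => _ _ _ [M M0 Mb].
have [n1 Hn1] : exists N, forall n, (N <= n)%N ->
    n.+1%:R^-1 < (`|a h l - phi h| / 2) ^+ 2 / g.
  by apply: natSinv_lt; rewrite divr_gt0 ?exprn_gt0 ?divr_gt0.
have hM : 0 < M * `|h| + 1 by rewrite ltr_wpDl ?mulr_ge0.
have [n2 Hn2] : exists N, forall n, (N <= n)%N ->
    `|l - x n| < (`|a h l - phi h| / 2) / (M * `|h| + 1).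
  by apply: xl; rewrite !divr_gt0.
pose n := maxn n1 n2.
have := ler_normD (a h (l - x n)) (a h (x n) - phi h).
rewrite cformBr addrA subrK; apply/negP; rewrite -real_ltNge ?realE ?normr_ge0//.
  rewrite -cformBr [ltRHS](splitr) ltr_leD//.
    apply: le_lt_trans (Mb _ _) _; rewrite mulrA.
    apply: (@le_lt_trans _ _ ((M * `|h| + 1) * `|l - x n|)).
      by rewrite ler_wpM2r// lerDl.
    by rewrite -ltr_pdivlMl// mulrC Hn2// leq_maxr.
  rewrite -(@ler_pXn2r _ 2)// ?nnegrE ?divr_ge0//; apply: le_trans (key n) _.
  by rewrite -ler_pdivlMl// mulrC ltW// Hn1// leq_maxl.
by rewrite addr_ge0.
Qed.

End Riesz.

End CoerciveForms.

Section Operators.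
Variables (R : realType) (H : hilbertType R).
Implicit Types (x y z h : H) (S T : bounded_op H).

Lemma form_sumr (a : H -> H -> R[i]) (ca : coercive_form a) (I : Type) (r : seq I)
    (f : I -> H) x : a x (\sum_(i <- r) f i) = \sum_(i <- r) a x (f i).
Proof.
elim/big_rec2: _ => [|i y1 y2 _ IH]; last by rewrite (cformDr ca) IH.
by rewrite (cformC ca) (cform0l ca) rmorph0.
Qed.

Lemma bounded_opB S x y : S (x - y) = S x - S y.
Proof. by rewrite bounded_opD -scaleN1r bounded_opZ scaleN1r. Qed.

(** [form_riesz] gives [Q h] pointwise; uniqueness of the representing vector makes it linear in
    [h], and coercivity makes it bounded. *)
Lemma form_op (a : H -> H -> R[i]) S : coercive_form a ->
  exists Q : bounded_op H, forall x h, a x (Q h) = inner (S x) h.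
Proof.
move=> ca; have [B B0 SB] := bounded_op_gt0 S.
have [q qE] : {q : H -> H & forall h x, a x (q h) = inner (S x) h}.
  apply: (@choice _ _ (fun h y => forall x, a x y = inner (S x) h)) => h.
  have [k x y|x|y hy] := @form_riesz _ _ _ ca (fun x => inner (S x) h) (B * `|h|).
  - by rewrite bounded_opD bounded_opZ innerDl innerZl.
  - apply: le_trans (Cauchy_Schwarz _ _) _.
    by rewrite mulrAC ler_wpM2r.
  by exists y => x.
have qb : q \in (@bounded_linear _ H).
  rewrite inE; split=> [k x y|].
    apply: (form_inj ca) => z.
    by rewrite (cformDr ca) (cformZr ca) !qE innerDr innerZr.
  case: (ca) => _ _ [c c0 cc] _; exists (B / c) => h.
  have [->|q0] := eqVneq (q h) 0.
    by rewrite normr0 mulr_ge0 ?divr_ge0 ?(ltW B0) ?(ltW c0).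
  rewrite mulrAC ler_pdivlMr// -(@ler_pM2r _ `|q h|) ?normr_gt0//.
  have -> : `|q h| * c * `|q h| = c * `|q h| ^+ 2 by ring.
  have -> : B * `|h| * `|q h| = B * `|q h| * `|h| by ring.
  apply: le_trans (cc _) _.
  apply: le_trans (real_ler_norm (ger0_real (form_ge0 ca _))) _.
  rewrite qE; apply: le_trans (Cauchy_Schwarz _ _) _.
  by rewrite ler_wpM2r.
by exists (BoundedOp qb) => x h; exact: qE.
Qed.

Lemma inner_coercive : coercive_form (@inner R H).
Proof.
split=> [k x y z|x y||].
- by rewrite innerDl innerZl.
- exact: innerC.
- by exists 1 => // x; rewrite mul1r sqr_norm_inner.
- by exists 1 => // x y; rewrite mul1r Cauchy_Schwarz.
Qed.

Definition adjoint S := projT1 (cid (form_op S inner_coercive)).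

Lemma adjointP S x y : inner (S x) y = inner x (adjoint S y).
Proof. by rewrite /adjoint; case: cid => /= Q ->. Qed.

Lemma adjointPr S x y : inner (adjoint S x) y = inner x (S y).
Proof. by rewrite innerC -adjointP -innerC. Qed.

(** * Finite orthonormal families and orthogonal residuals *)

Definition orthonormal_seq (s : seq H) := forall i j, (i < size s)%N -> (j < size s)%N ->
  inner s`_i s`_j = (i == j)%:R.

(** For orthonormal [s] this is the component of [x] orthogonal to the span of [s]; it vanishes
    exactly on that span. *)
Definition residual (s : seq H) x := x - \sum_(u <- s) inner x u *: u.

Lemma orthonormal_seq_norm s u : orthonormal_seq s -> u \in s -> `|u| = 1.
Proof.
move=> os /(nthP 0)[i si <-]; apply/eqP.
by rewrite -(@eqrXn2 _ 2)// ?expr1n ?sqr_norm_inner ?os// eqxx.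
Qed.

Lemma orthonormal_seq_rcons s v : orthonormal_seq s ->
  (forall u, u \in s -> inner v u = 0) ->
  `|v| = 1 -> orthonormal_seq (rcons s v).
Proof.
move=> os vs v1 i j; rewrite !size_rcons !ltnS !nth_rcons (leq_eqVlt i) (leq_eqVlt j).
have vv : inner v v = 1 by rewrite -sqr_norm_inner v1 expr1n.
case/predU1P=> [->|si] /predU1P[->|sj].
- by rewrite ltnn eqxx vv.
- by rewrite ltnn eqxx sj (gtn_eqF sj) vs// mem_nth.
- by rewrite ltnn eqxx si (ltn_eqF si) (inner_eq0C (vs _ _))// mem_nth.
- by rewrite si sj os.
Qed.

Lemma orthonormal_seq_sum s (c : H -> R[i]) u : orthonormal_seq s -> u \in s ->
  inner (\sum_(v <- s) c v *: v) u = c u.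
Proof.
move=> os /(nthP 0)[i si <-]; rewrite inner_suml (big_nth 0) big_mkord.
rewrite (bigD1 (Ordinal si))//= innerZl os// eqxx mulr1 big1 ?addr0// => j ji.
by rewrite innerZl os// (_ : (j == i :> nat) = false) ?mulr0//; apply/negbTE.
Qed.

Lemma residual_orth s x u : orthonormal_seq s -> u \in s -> inner (residual s x) u = 0.
Proof. by move=> os us; rewrite innerBl orthonormal_seq_sum// subrr. Qed.

Lemma residual_rcons s x v : residual (rcons s v) x = residual s x - inner x v *: v.
Proof. by rewrite /residual -cats1 big_cat big_seq1 opprD addrA. Qed.

Lemma inner_residual s x v : (forall u, u \in s -> inner v u = 0) ->
  inner (residual s x) v = inner x v.
Proof.
move=> vs; rewrite innerBl inner_suml big_seq big1 ?subr0// => u /vs vu.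
by rewrite innerZl (inner_eq0C vu) mulr0.
Qed.

Lemma norm_residual_rcons s x v : (forall u, u \in s -> inner v u = 0) -> `|v| = 1 ->
  `|residual (rcons s v) x| ^+ 2 = `|residual s x| ^+ 2 - `|inner x v| ^+ 2.
Proof.
move=> vs v1; rewrite residual_rcons; set r := residual s x.
have o : inner (r - inner x v *: v) (inner x v *: v) = 0.
  rewrite innerZr innerBl innerZl -sqr_norm_inner v1 expr1n mulr1.
  by rewrite inner_residual// subrr mulr0.
by have := pythagoras o; rewrite subrK => ->; rewrite normrZ v1 mulr1 addrK.
Qed.

Lemma residual0_orth s f x : residual s f = 0 -> (forall u, u \in s -> inner x u = 0) ->
  inner x f = 0.
Proof.
move=> /subr0_eq-> xs; rewrite inner_sumr big_seq big1// => u /xs xu.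
by rewrite innerZr xu mulr0.
Qed.

Lemma Gram_Schmidt (F : seq H) :
  exists E, orthonormal_seq E /\ forall f, f \in F -> residual E f = 0.
Proof.
elim: F => [|f F [E [oE EF]]]; first by exists [::].
have [r0|r0] := eqVneq (residual E f) 0.
  by exists E; split=> // g; rewrite inE => /predU1P[->|/EF].
set r := residual E f in r0 *; pose v := `|r|^-1 *: r.
have v1 : `|v| = 1 by rewrite normrZ normfV normr_id mulVf// normr_eq0.
have vE u : u \in E -> inner v u = 0.
  by move=> uE; rewrite innerZl residual_orth// mulr0.
exists (rcons E v); split; first exact: orthonormal_seq_rcons.
move=> g; rewrite inE => /predU1P[->|gF].
  have rv : inner r v = `|r|.
    rewrite innerZr -sqr_norm_inner (CrealP _) ?rpredV ?normr_real//.
    by rewrite expr2 mulKf// normr_eq0.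
  rewrite residual_rcons -(inner_residual f vE) -/r rv /v scalerA mulfV ?normr_eq0//.
  by rewrite scale1r subrr.
by rewrite residual_rcons EF// (inner_eq0C (residual0_orth (EF _ gF) vE)) scale0r subrr.
Qed.

Lemma norm_residual s x : orthonormal_seq s ->
  `|x| ^+ 2 = `|residual s x| ^+ 2 + \sum_(u <- s) `|inner x u| ^+ 2.
Proof.
move=> os; have o : inner (residual s x) (\sum_(u <- s) inner x u *: u) = 0.
  rewrite inner_sumr big_seq big1// => u us.
  by rewrite innerZr residual_orth// mulr0.
have := pythagoras o; rewrite subrK => ->; congr (_ + _).
rewrite sqr_norm_inner inner_sumr big_seq [RHS]big_seq; apply: eq_bigr => u us.
by rewrite innerZr orthonormal_seq_sum// normCK mulrC.
Qed.

End Operators.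

(** * Approximate eigenvectors on the essential spectrum *)

Lemma norm_real_complex (R : rcfType) (t : R) : `|t%:C| = `|t|%:C.
Proof. by rewrite normc_def/= expr0n addr0 sqrtr_sqr. Qed.

Lemma normc_ge_Im (R : rcfType) (c : R[i]) : `|complex.Im c|%:C <= `|c|.
Proof.
by rewrite normc_def lecR -sqrtr_sqr ler_wsqrtr// lerDr sqr_ge0.
Qed.

Section Fredholm.
Variables (R : realType) (H : hilbertType R).
Implicit Types (x y z h : H) (S T : bounded_op H).

(* The Lax-Milgram operator of the form a below inverts S^* S + P_E, and
   Q = (S^* S + P_E)^-1 S^*. *)
Lemma left_parametrix S (E : seq H) (e : R[i]) : orthonormal_seq E -> 0 < e ->
  (forall v, (forall u, u \in E -> inner v u = 0) -> e * `|v| <= `|S v|) ->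
  exists (Q : bounded_op H) (g : H -> H),
    forall x, Q (S x) = x - \sum_(u <- E) inner x u *: g u.
Proof.
move=> oE e0 SE; have [B B0 SB] := bounded_op_gt0 S.
pose a x y := inner (S x) (S y) + \sum_(u <- E) inner x u * inner u y.
have ca : coercive_form a.
  split=> [k x y z|x y||].
  - rewrite /a bounded_opD bounded_opZ innerDl innerZl mulrDr addrACA; congr (_ + _).
    rewrite mulr_sumr -big_split; apply: eq_bigr => u _.
    by rewrite innerDl innerZl mulrDl mulrA.
  - rewrite /a rmorphD/= -innerC rmorph_sum; congr (_ + _); apply: eq_bigr => u _.
    by rewrite rmorphM/= -!innerC mulrC.
  (* With [q] the projection of [x] on the span of [E] and [p = |q|^2], the bound
     [e |x - q| <= |S x| + B |q|] gives [|x|^2 <= K (|S x|^2 + p)]. *)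
  - pose K := (2 + 2 * B ^+ 2) / e ^+ 2 + 1.
    have K0 : 0 < K.
      by rewrite ltr_wpDl// divr_ge0 ?exprn_ge0 ?addr_ge0 ?mulr_ge0 ?exprn_ge0 ?ltW.
    exists K^-1 => [|x]; first by rewrite invr_gt0.
    rewrite mulrC ler_pdivrMr// (norm_residual x oE).
    set p := \sum_(u <- E) `|inner x u| ^+ 2.
    have p0 : 0 <= p by apply: sumr_ge0 => u _; rewrite exprn_ge0.
    have -> : a x x = `|S x| ^+ 2 + p.
      rewrite /a sqr_norm_inner; congr (_ + _); apply: eq_bigr => u _.
      by rewrite normCK -innerC.
    set q := \sum_(u <- E) inner x u *: u.
    have qp : `|q| ^+ 2 = p.
      apply: (addrI (`|residual E x| ^+ 2)); rewrite -norm_residual//.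
      rewrite -[in RHS](subrK q x); apply/esym/pythagoras.
      rewrite inner_sumr big_seq big1// => u us.
      by rewrite innerZr residual_orth// mulr0.
    have le1 : (e * `|residual E x|) ^+ 2 <= 2 * `|S x| ^+ 2 + 2 * (B ^+ 2 * p).
      apply: (@le_trans _ _ ((`|S x| + B * `|q|) ^+ 2)).
        rewrite ler_pXn2r ?nnegrE ?mulr_ge0 ?addr_ge0 ?mulr_ge0 ?(ltW e0) ?(ltW B0)//.
        apply: le_trans (SE _ (fun u => residual_orth _ oE)) _.
        rewrite bounded_opB; apply: le_trans (ler_normB _ _) _.
        by rewrite lerD2l SB.
      rewrite -qp -subr_ge0.
      have -> : 2 * `|S x| ^+ 2 + 2 * (B ^+ 2 * `|q| ^+ 2) - (`|S x| + B * `|q|) ^+ 2 =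
        (`|S x| - B * `|q|) ^+ 2 by ring.
      by rewrite real_exprn_even_ge0// rpredB ?rpredM ?normr_real// gtr0_real.
    have -> : (`|S x| ^+ 2 + p) * K = (2 * `|S x| ^+ 2 + 2 * (B ^+ 2 * p)) / e ^+ 2 +
       p + ((2 * B ^+ 2) / e ^+ 2 * `|S x| ^+ 2 + 2 / e ^+ 2 * p + `|S x| ^+ 2).
      by rewrite /K; field; rewrite gt_eqF.
    rewrite -[leLHS]addr0 lerD ?lerD//.
      by rewrite ler_pdivlMr ?exprn_gt0// mulrC -exprMn.
    have e20 : 0 <= (e ^+ 2)^-1 by rewrite invr_ge0 exprn_ge0// ltW.
    have B20 : 0 <= 2 * B ^+ 2 by rewrite mulr_ge0// exprn_ge0// ltW.
    apply: addr_ge0; last by rewrite exprn_ge0.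
    by apply: addr_ge0; apply: mulr_ge0; rewrite ?exprn_ge0// mulr_ge0.
  - exists (B ^+ 2 + \sum_(u <- E) `|u| ^+ 2).
      rewrite addr_ge0 ?exprn_ge0 ?(ltW B0)//; apply: sumr_ge0 => u _.
      by rewrite exprn_ge0.
    move=> x y; rewrite mulrDl mulr_suml.
    apply: le_trans (ler_normD _ _) _; apply: lerD.
      apply: le_trans (Cauchy_Schwarz _ _) _; rewrite expr2 mulrACA.
      by rewrite ler_pM.
    apply: le_trans (ler_norm_sum _ _ _) _; apply: ler_sum => u _.
    rewrite normrM expr2.
    have -> : `|u| * `|u| * (`|x| * `|y|) = (`|x| * `|u|) * (`|u| * `|y|) by ring.
    by rewrite ler_pM// Cauchy_Schwarz.
have [Q QE] := form_op S ca.
(* [g u] is the image of [u] under the inverse of the operator attached to [a]. *)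
have [g gE] : {g : H -> H & forall u x, inner x u = a x (g u)}.
  apply: (@choice _ _ (fun u y => forall x, inner x u = a x y)) => u.
  apply: (form_riesz ca (N := `|u|)) => [k x y|x]; first by rewrite innerDl innerZl.
  by rewrite mulrC Cauchy_Schwarz.
exists Q, g => x; apply: (form_inj ca) => y.
rewrite QE (cformBr ca) (form_sumr ca) {1}/a -addrA [X in _ + X](_ : _ = 0) ?addr0//.
rewrite -sumrB big1// => u _.
by rewrite (cformZr ca) -gE -(innerC u x) mulrC subrr.
Qed.

(** * Compactness of finite rank operators *)

Section FiniteRank.
Variables (I : Type) (r : seq I) (f g : I -> H).

Lemma rank1_bounded e y : (fun x => inner x e *: y) \in (@bounded_linear _ H).
Proof.
rewrite inE; split=> [k x z|].
  by rewrite innerDl innerZl scalerDl scalerA.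
exists (`|e| * `|y|) => x; rewrite normrZ mulrAC ler_wpM2r// mulrC.
exact: Cauchy_Schwarz.
Qed.

Definition rank1 e y : bounded_op H := BoundedOp (rank1_bounded e y).

(** The image of the unit ball lies in the continuous image of a compact square of [R * R]: the
    coefficient of [y] has real and imaginary parts bounded by [|e|]. *)
Lemma rank1_compact e y : rank1 e y \in @compact_op _ H.
Proof.
rewrite inE /=; pose M := complex.Re `|e|.
apply: (@compact_image_precompact _ _ (R * R)%type
  (fun p => p.1%:C *: y + p.2%:C *: ('i%C *: y)) (`[- M, M] `*` `[- M, M])).
- have cR (z : H) : continuous (fun t : R => t%:C *: z).
    move=> t; apply/cvgrPdist_lt => d d0.
    have dr := gtr0_real d0.
    have zr : `|z| \is Num.real by exact: normr_real.
    have z1 : 0 < complex.Re `|z| + 1.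
      by rewrite ltr_wpDl// -ler0c RRe_real.
    near=> s; rewrite -scalerBl -rmorphB normrZ norm_real_complex.
    rewrite -(RRe_real dr) -(RRe_real zr) -rmorphM ltcR.
    apply: le_lt_trans (_ : `|t - s| * (complex.Re `|z| + 1) < _).
      by rewrite ler_wpM2l// lerDl.
    rewrite -ltr_pdivlMr//; near: s; apply: cvgr_dist_lt => //.
    by rewrite divr_gt0// -(ltcR 0) RRe_real.
  move=> p; apply: (@continuousD _ _ _ (fun p : R * R => p.1%:C *: y)
      (fun p : R * R => p.2%:C *: ('i%C *: y))).
    apply: (@continuous_comp _ _ _ fst (fun t : R => t%:C *: y)); last exact: cR.
    exact: cvg_fst.
  apply: (@continuous_comp _ _ _ snd (fun t : R => t%:C *: ('i%C *: y))).
    exact: cvg_snd.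
  exact: cR.
- by apply: compact_setX; exact: segment_compact.
- move=> _ [x /= x1 <-]; set c := inner x e.
  have le1 : `|c| <= `|e|.
    by apply: le_trans (Cauchy_Schwarz _ _) _; rewrite -[leRHS]mul1r ler_wpM2r.
  have eM : `|e| = M%:C by rewrite /M RRe_real// normr_real.
  exists (complex.Re c, complex.Im c) => /=; last first.
    by rewrite scalerA -scalerDl mulrC -complexE.
  rewrite eM in le1.
  split; rewrite /= in_itv/= -ler_norml -lecR; apply: le_trans le1.
    exact: normc_ge_Re.
  exact: normc_ge_Im.
Unshelve. all: by end_near. Qed.

Lemma finite_rank_compact (K : bounded_op H) :
  (forall x, K x = \sum_(i <- r) inner x (f i) *: g i) -> K \in @compact_op _ H.
Proof.
move=> KE; rewrite (_ : K = \sum_(i <- r) rank1 (f i) (g i)).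
  by apply: rpred_sum => i _; exact: rank1_compact.
apply/bounded_op_eqP => x; rewrite KE.
by elim: (r) => [|i s IH]; rewrite ?big_nil// !big_cons IH.
Qed.

End FiniteRank.

(* If the conclusion fails, both T - z and its adjoint are bounded below on a
   subspace of finite codimension, hence T - z has a left and a right inverse
   modulo finite rank operators. *)
Lemma essential_spectrum_approx T (z : R[i]) (F : seq H) (e : R[i]) :
  essential_spectrum T z -> 0 < e ->
  exists v, [/\ `|v| = 1, forall f, f \in F -> inner v f = 0 &
    `|(T - z *: id_op H) v| <= e \/ `|adjoint (T - z *: id_op H) v| <= e].
Proof.
move=> sT e0; set S := T - _; apply: contrapT => nv; apply: sT.
have [E [oE EF]] := Gram_Schmidt F.
have low (S' : bounded_op H) : S' = S \/ S' = adjoint S ->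
    forall v, (forall u, u \in E -> inner v u = 0) -> e * `|v| <= `|S' v|.
  move=> S'E v vE; have [->|v0] := eqVneq v 0.
    by rewrite normr0 mulr0.
  rewrite real_leNgt ?rpredM ?normr_real ?gtr0_real//; apply/negP => lt1; apply: nv.
  exists (`|v|^-1 *: v); split=> [|f fF|].
  - by rewrite normrZ normfV normr_id mulVf// normr_eq0.
  - by rewrite innerZl (residual0_orth (EF f fF) vE) mulr0.
  - have : `|S' (`|v|^-1 *: v)| <= e.
      rewrite bounded_opZ normrZ normfV normr_id mulrC ler_pdivrMr ?normr_gt0//.
      exact: ltW.
    by case: S'E => ->; [left|right].
have [Q [g QE]] := left_parametrix oE e0 (low _ (or_introl erefl)).
have [Q' [g' QE']] := left_parametrix oE e0 (low _ (or_intror erefl)).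
have aE : \pi_(calkin H) T - \pi_(calkin H) (z *: id_op H) = \pi_(calkin H) S.
  by rewrite -[T](subrK (z *: id_op H)) -pi_calkinD addrK.
rewrite aE.
have lQ : \pi_(calkin H) Q * \pi_(calkin H) S = 1.
  rewrite [LHS]pi_calkinM; apply/calkin_eqP.
  apply: (@finite_rank_compact _ E id (fun u => - g u)) => x.
  change (Q (S x) - x = \sum_(i <- E) inner x i *: - g i).
  rewrite QE addrC addKr -sumrN; apply: eq_bigr => u _; by rewrite scalerN.
(* Taking adjoints in the relation for [Q'] and [adjoint S] turns a left inverse modulo finite rank
   into a right inverse of [S]. *)
have rQ : \pi_(calkin H) S * \pi_(calkin H) (adjoint Q') = 1.
  rewrite [LHS]pi_calkinM; apply/calkin_eqP.
  apply: (@finite_rank_compact _ E g' (fun u => - u)) => x.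
  change (S (adjoint Q' x) - x = \sum_(i <- E) inner x (g' i) *: - i).
  apply: (canLR (addrK _)); apply: inner_inj => y.
  rewrite -adjointPr -adjointP QE' innerBl innerDr inner_suml inner_sumr addrC -sumrN.
  congr (_ + _); apply: eq_bigr => u _.
  rewrite innerZl innerZr -(innerC (g' u) x) -(scaleN1r u) innerZr rmorphN1.
  by rewrite mulN1r mulrN mulrC.
exists (\pi_(calkin H) Q); split=> //.
by rewrite -[X in _ * X = _]mulr1 -rQ [X in _ * X]mulrA lQ mul1r rQ.
Qed.
End Fredholm.

(** * Integer powers on approximate eigenvectors *)

Section EssentialPoints.
Variables (R : realType) (H : hilbertType R).
Implicit Types (S T D G : bounded_op H).

Lemma op_scalel (c : R[i]) S T : (c *: S) * T = c *: (S * T).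
Proof. exact/bounded_op_eqP. Qed.

Lemma op_scaler (c : R[i]) S T : S * (c *: T) = c *: (S * T).
Proof. by apply/bounded_op_eqP => x; exact: bounded_opZ. Qed.

Lemma op_mul1l S : id_op H * S = S. Proof. exact: mul1r. Qed.

Lemma op_mul1r S : S * id_op H = S. Proof. exact: mulr1. Qed.

Lemma inverseP T : invertible T -> inverse T * T = 1 /\ T * inverse T = 1.
Proof.
by move=> bT; exact: (@xgetPex _ 0 [set b | b * T = 1 /\ T * b = 1]).
Qed.

(** Induction on [A^(n+1) - w^(n+1) = A (A^n - w^n) + w^n (A - w)]. Both factorisations are kept:
    [G * D] serves vectors with small [D v], and [D * G] those with small [adjoint D v]. *)
Lemma power_subE (A D : bounded_op H) (w : R[i]) n : A * D = D * A ->
  (exists G, A - w *: id_op H = G * D /\ A - w *: id_op H = D * G) ->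
  exists G, A ^+ n - w ^+ n *: id_op H = G * D /\ A ^+ n - w ^+ n *: id_op H = D * G.
Proof.
move=> AD [G [GD DG]]; elim: n => [|n [F [FD DF]]].
  by exists 0; rewrite !expr0 scale1r [_ - _]subrr mul0r mulr0.
exists (A * F + w ^+ n *: G).
have -> : A ^+ n.+1 - w ^+ n.+1 *: id_op H =
    A * (A ^+ n - w ^+ n *: id_op H) + w ^+ n *: (A - w *: id_op H).
  rewrite mulrBr -exprS op_scaler op_mul1r scalerBr scalerA -exprSr addrA.
  by rewrite subrK.
split; first by rewrite FD GD mulrDl op_scalel mulrA.
by rewrite DF DG mulrDr op_scaler !mulrA AD.
Qed.

Lemma int_power_subE T (z : R[i]) (l : int) : invertible T -> z != 0 ->
  let D := T - z *: id_op H in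
  exists G, int_power T l - z ^ l *: id_op H = G * D /\
    int_power T l - z ^ l *: id_op H = D * G.
Proof.
move=> /inverseP[iT Ti] z0 D.
have TD : T * D = D * T.
  by rewrite mulrBr mulrBl op_scaler op_scalel op_mul1r op_mul1l.
case: l => n.
  by apply: power_subE => //; exists 1; rewrite mul1r mulr1.
rewrite [z ^ _](_ : _ = z^-1 ^+ n.+1); last by rewrite exprVn.
apply: power_subE.
  rewrite mulrBr mulrBl iT Ti op_scaler op_scalel.
  by rewrite op_mul1r op_mul1l.
(* This is the identity [T^-1 - z^-1 = - z^-1 T^-1 (T - z)]. *)
exists (- (z^-1 *: inverse T)).
have zz : z^-1 * z = 1 by rewrite mulVf.
split.
  rewrite mulNr op_scalel mulrBr iT op_scaler op_mul1r.
  by rewrite scalerBr scalerA zz scale1r opprB.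
rewrite mulrN op_scaler mulrBl Ti op_scalel op_mul1l.
by rewrite scalerBr scalerA zz scale1r opprB.
Qed.

(** These are the points [p] of the joint essential numerical range of the family [A]. *)
Definition essential_point (I : Type) (A : I -> bounded_op H) (p : I -> R[i]) :=
  forall (F : seq H) (e : R[i]), 0 < e ->
  exists v, [/\ `|v| = 1, forall f, f \in F -> inner v f = 0 &
    forall i, `|inner (A i v) v - p i| <= e].

Lemma essential_spectrum_point (I : finType) (l : I -> int) T (z : R[i]) :
  invertible T -> z != 0 -> essential_spectrum T z ->
  essential_point (fun i => int_power T (l i)) (fun i => z ^ l i).
Proof.
move=> iT z0 sT F e e0; set D := T - z *: id_op H.
have [G GE] := choice (fun i => int_power_subE (l i) iT z0).
have [B BE] := choice (fun i => (let: ex_intro2 M M0 MG := bounded_op_gt0 (G i) in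
  ex_intro (fun M => 0 < M /\ forall x, `|G i x| <= M * `|x|) M (conj M0 MG))).
pose b := \sum_i B i + 1.
have b0 : 0 < b.
  by rewrite ltr_wpDl//; apply: sumr_ge0 => i _; rewrite ltW//; case: (BE i).
have Bb i : B i <= b.
  rewrite /b (bigD1 i)//= -addrA lerDl addr_ge0//.
  by apply: sumr_ge0 => j _; rewrite ltW//; case: (BE j).
have [v [v1 vF vD]] := essential_spectrum_approx F sT (divr_gt0 e0 b0).
exists v; split=> // i.
have -> : inner (int_power T (l i) v) v - z ^ l i =
    inner ((int_power T (l i) - z ^ l i *: id_op H) v) v.
  change (inner (int_power T (l i) v) v - z ^ l i =
    inner (int_power T (l i) v - z ^ l i *: v) v).
  by rewrite innerBl innerZl -(sqr_norm_inner v) v1 expr1n mulr1.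
have [_ GB] := BE i; have [GD DG] := GE i.
have fin (u : H) : `|u| <= e / b -> B i * `|u| <= e.
  move=> ub; rewrite -[leRHS](@divfK _ b) ?gt_eqF// mulrC.
  by rewrite ler_pM// ltW//; case: (BE i).
case: vD => vD.
  rewrite GD; apply: le_trans (Cauchy_Schwarz _ _) _; rewrite v1 mulr1.
  by apply: le_trans (GB _) _; exact: fin.
(* Here [D] moves to the other side of the inner product, where [adjoint D v] is small. *)
rewrite DG [X in inner X _](_ : _ = D (G i v))// adjointP.
apply: le_trans (Cauchy_Schwarz _ _) _.
apply: le_trans (fin _ vD); rewrite ler_wpM2r//.
by apply: le_trans (GB _) _; rewrite v1 mulr1.
Qed.

End EssentialPoints.

(** * Exact prescription of the moments *)

Section EssentialVectors.
Variables (R : realType) (H : hilbertType R) (I : finType) (A : I -> bounded_op H).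

(** A vector orthogonal to this list has no cross term, in either order, with any [u] in [us] under
    any [A i]. *)
Definition neighbours (us : seq H) : seq H :=
  us ++ [seq A i u | i <- enum I, u <- us] ++
  [seq adjoint (A i) u | i <- enum I, u <- us].

Lemma neighbours_orth v us u : (forall f, f \in neighbours us -> inner v f = 0) ->
  u \in us ->
  [/\ inner v u = 0, forall i, inner (A i u) v = 0 & forall i, inner (A i v) u = 0].
Proof.
move=> vf uus; split=> [|i|i].
- by apply: vf; rewrite mem_cat uus.
- apply/inner_eq0C/vf; rewrite !mem_cat; apply/orP; right; apply/orP; left.
  by apply/allpairsP; exists (i, u); rewrite mem_enum.
- rewrite adjointP; apply: vf; rewrite !mem_cat; apply/orP; right; apply/orP; right.
  by apply/allpairsP; exists (i, u); rewrite mem_enum.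
Qed.

(** The vectors are chosen one after another, each orthogonal to [F] and to the neighbours of its
    predecessors. *)
Lemma essential_vectors (Q : finType) (p : I -> Q -> R[i]) (F : seq H) (d : R[i]) :
  (forall q, essential_point A (p^~ q)) -> 0 < d ->
  exists v : Q -> H, [/\ forall q, `|v q| = 1,
    forall q f, f \in F -> inner (v q) f = 0,
    forall q q' i, q != q' -> inner (A i (v q)) (v q') = 0 &
    forall i q, `|inner (A i (v q)) (v q) - p i q| <= d].
Proof.
move=> ep d0.
suff [v [v1 vF vv vp]] : exists v : Q -> H, [/\ {in enum Q, forall q, `|v q| = 1},
    {in enum Q, forall q f, f \in F -> inner (v q) f = 0},
    {in enum Q &, forall q q', q != q' -> forall i, inner (A i (v q)) (v q') = 0} &
    {in enum Q, forall q i, `|inner (A i (v q)) (v q) - p i q| <= d}].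
  by exists v; split=> [q|q f|q q' i qq'|i q];
    [apply: v1|apply: vF|apply: vv|apply: vp]; rewrite ?mem_enum.
elim: (enum Q) (enum_uniq Q) => [|q0 s IH] /=; first by exists (fun=> 0).
move=> /andP[q0s /IH[v [v1 vF vv vp]]].
have [x [x1 xF xp]] := ep q0 (F ++ neighbours (map v s)) d d0.
have xo q : q \in s -> [/\ inner x (v q) = 0, forall i, inner (A i (v q)) x = 0 &
    forall i, inner (A i x) (v q) = 0].
  move=> qs; apply: (@neighbours_orth _ (map v s)); last exact: map_f.
  by move=> f fs; apply: xF; rewrite mem_cat fs orbT.
pose v' q := if q == q0 then x else v q.
have v'0 : v' q0 = x by rewrite /v' eqxx.
have v's q : q \in s -> v' q = v q.
  by rewrite /v' => qs; case: eqP => // qq0; rewrite -qq0 qs in q0s.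
exists v'; split.
- by move=> q; rewrite inE => /predU1P[->|qs]; rewrite ?v'0// v's// v1.
- move=> q; rewrite inE => /predU1P[->|qs] f fF; last by rewrite v's// vF.
  by rewrite v'0 xF// mem_cat fF.
- move=> q q'; rewrite !inE => /predU1P[->|qs] /predU1P[->|q's] qq' i.
  + by rewrite eqxx in qq'.
  + by rewrite v'0 v's//; have [] := xo _ q's.
  + by rewrite v'0 v's//; have [] := xo _ qs.
  + by rewrite !v's// vv.
- move=> q; rewrite inE => /predU1P[->|qs] i; first by rewrite v'0.
  by rewrite v's// vp.
Qed.

End EssentialVectors.

Section ExactMoments.
Variables (R : realType) (H : hilbertType R).

(** Without cross terms, the moments of a sqrt-weighted sum are the weighted sums of the moments.
    The weights are chosen after the vectors, so [circle_weights] absorbs the error in their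
    moments; [d] comes from [circle_weights] and precedes both [F] and [lam]. *)
Lemma exact_moments (T : bounded_op H) (k : nat) (r s : R[i]) :
  invertible T -> 0 < r -> r < s ->
  (forall z : R[i], `|z| = r \/ `|z| = s -> essential_spectrum T z) ->
  exists2 d : R[i], 0 < d & forall (F : seq H) (lam : 'I_(k.*2.+1) -> R[i]),
    (forall m : 'I__, m != k :> nat -> `|lam m| <= d) ->
    exists v, [/\ `|v| = 1, forall f, f \in F -> inner v f = 0 &
      forall m : 'I__, m != k :> nat -> inner (int_power T (exponent m) v) v = lam m].
Proof.
move=> iT r0 rs sT.
have [w pw] := @exists_prim_root R[i] k.*2.+1 isT.
have [d d0 dW] := circle_weights pw r0 rs.
exists d => // F lam0 ld.
pose lam (m : 'I_(k.*2.+1)) := if m == k :> nat then 1 else lam0 m.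
pose A (m : 'I_(k.*2.+1)) := int_power T (exponent m).
pose z := circle_point w r s (k := k).
have zn q : `|z q| = circle_radius r s q.1 by exact: norm_circle_point.
have ep q : essential_point A (fun m => z q ^ exponent m).
  apply: essential_spectrum_point => //.
    by rewrite -normr_eq0 zn gt_eqF// circle_radius_gt0.
  by apply: sT; rewrite zn /circle_radius; case: q.1; [right|left].
have [v [v1 vF vv vp]] := essential_vectors F ep d0.
have [||||u u0 uE] := dW (fun m q => inner (A m (v q)) (v q)) lam.
- by [].
- move=> m q /eqP mk; rewrite /A /exponent mk subrr /int_power.
  by rewrite -[RHS](expr1n _ 2) -(v1 q) sqr_norm_inner.
- by move=> m mk; rewrite /lam mk.
- by move=> m mk; rewrite /lam (negbTE mk) ld.
pose x := \sum_q sqrtC (u q) *: v q.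
have Ax m : inner (A m x) x = lam m.
  rewrite -uE.
  have -> : A m x = \sum_q sqrtC (u q) *: A m (v q).
    rewrite /x; elim/big_rec2: _ => [|q y1 y2 _ <-]; first by rewrite bounded_op0.
    by rewrite bounded_opD bounded_opZ.
  rewrite inner_suml; apply: eq_bigr => q _.
  rewrite innerZl inner_sumr (bigD1 q)//= big1 ?addr0 => [|q' qq'].
    rewrite innerZr (CrealP _) ?ger0_real ?sqrtC_ge0//.
    by rewrite mulrA -expr2 sqrtCK mulrC.
  by rewrite innerZr vv 1?eq_sym// mulr0.
exists x; split.
(* The norm is read off from the moment of exponent 0, prescribed to be 1. *)
- apply/eqP; rewrite -(@eqrXn2 _ 2)// expr1n sqr_norm_inner; apply/eqP.
  have kn : (k < k.*2.+1)%N by exact: k_lt_n.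
  rewrite -[RHS](_ : lam (Ordinal kn) = 1); last by rewrite /lam /= eqxx.
  by rewrite -Ax /A /exponent subrr.
- move=> f fF; rewrite inner_suml big1// => q _.
  by rewrite innerZl vF// mulr0.
- by move=> m mk; rewrite Ax /lam (negbTE mk).
Qed.

End ExactMoments.

(** * Inductive construction of the basis *)

Section Construction.
Variables (R : realType) (H : hilbertType R) (I : finType) (A : I -> bounded_op H).
Variable d : R[i].
Hypothesis d0 : 0 < d.
Hypothesis realize : forall (F : seq H) (lam : I -> R[i]), (forall i, `|lam i| <= d) ->
  exists v, [/\ `|v| = 1, forall f, f \in F -> inner v f = 0 &
    forall i, inner (A i v) v = lam i].
Variable B : set (nat * nat).
Hypothesis admB : admissible B.

Definition partial_basis (s : seq H) :=
  orthonormal_seq s /\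
  forall n j, (n < size s)%N -> (j < size s)%N -> (B `|` diagonal) (n, j) ->
    forall i, inner (A i s`_j) s`_n = 0.

Lemma partial_basis_rcons s v : partial_basis s -> `|v| = 1 ->
  (forall u, u \in s -> inner v u = 0) -> (forall i, inner (A i v) v = 0) ->
  (forall j i, (j < size s)%N -> B (size s, j) -> inner (A i s`_j) v = 0) ->
  (forall n i, (n < size s)%N -> B (n, size s) -> inner (A i v) s`_n = 0) ->
  partial_basis (rcons s v).
Proof.
move=> [os bs] v1 vs vv vl vr; split; first exact: orthonormal_seq_rcons.
have nBd : ~ B (size s, size s) by move=> /(proj1 admB) /=; apply.
move=> n j; rewrite !size_rcons !ltnS !nth_rcons (leq_eqVlt n) (leq_eqVlt j).
move=> /predU1P[->|ns] /predU1P[->|js] b i.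
- by rewrite ltnn eqxx.
- rewrite ltnn eqxx js; apply: vl => //; case: b => // e.
  by move: js; rewrite -[X in (X < _)%N](e : size s = j) ltnn.
- rewrite ltnn eqxx ns; apply: vr => //; case: b => // e.
  by move: ns; rewrite [X in (X < _)%N](e : n = size s) ltnn.
- by rewrite ns js; exact: bs.
Qed.

(** This fills the indices up to one given by admissibility. Each added vector has zero moments and
    no cross terms with its predecessors, so every pair of [B] is respected. *)
Lemma partial_basis_pad (s F : seq H) N : partial_basis s ->
  exists t, [/\ partial_basis (s ++ t), size t = N &
    forall u f : H, u \in t -> f \in F -> inner u f = 0].
Proof.
move=> bs; elim: N => [|N [t [bt tN tF]]]; first by exists [::]; rewrite cats0.
have [v [v1 vF vv]] := @realize (F ++ neighbours A (s ++ t)) (fun=> 0)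
  (fun i => ltac:(by rewrite normr0 ltW)).
have vo u : u \in s ++ t -> [/\ inner v u = 0, forall i, inner (A i u) v = 0 &
    forall i, inner (A i v) u = 0].
  by apply: neighbours_orth => f fs; apply: vF; rewrite mem_cat fs orbT.
exists (rcons t v); rewrite size_rcons tN -rcons_cat; split=> //.
  apply: partial_basis_rcons => //.
  - by move=> u /vo[].
  - by move=> j i js _; have [|_ + _] := vo (s ++ t)`_j; [exact: mem_nth|apply].
  - by move=> n i ns _; have [|_ _] := vo (s ++ t)`_n; [exact: mem_nth|apply].
move=> u f; rewrite mem_rcons inE => /predU1P[->|ut] fF; last exact: tF.
by apply: vF; rewrite mem_cat fF.
Qed.

Lemma norm_residual_cat (s t : seq H) x : orthonormal_seq (s ++ t) ->
  `|residual (s ++ t) x| ^+ 2 <= `|residual s x| ^+ 2.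
Proof.
elim/last_ind: t => [|t v IH]; first by rewrite cats0.
rewrite -rcons_cat => o.
have ost : orthonormal_seq (s ++ t).
  move=> i j si sj; have := o i j; rewrite size_rcons !ltnS !nth_rcons si sj.
  by apply; exact: ltnW.
have lastE : (rcons (s ++ t) v)`_(size (s ++ t)) = v by rewrite nth_rcons ltnn eqxx.
have v1 : `|v| = 1 by apply: (orthonormal_seq_norm o); rewrite mem_rcons mem_head.
rewrite norm_residual_rcons//.
  by apply: le_trans (IH ost); rewrite gerBl exprn_ge0.
move=> _ /(nthP 0)[i si <-]; have := o (size (s ++ t)) i.
rewrite size_rcons lastE nth_rcons si => ->//; last exact: ltnW.
by rewrite gtn_eqF.
Qed.

(* The new vector is u = c y + b v, where y is the normalised residual of e, c
   is small and v is orthogonal to everything so far with <A_i v, v> chosen to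
   cancel c^2 <A_i y, y>.  Its index is provided by admissibility; the generic
   vectors filling the gap before it are orthogonal to y, A_i y and A_i^* y. *)
Lemma partial_basis_step : exists2 g : R[i], 0 < g < 1 & forall s e, partial_basis s ->
  exists t, [/\ partial_basis (s ++ t), (0 < size t)%N &
    `|residual (s ++ t) e| ^+ 2 <= (1 - g) * `|residual s e| ^+ 2].
Proof.
have [M ME] := choice (fun i => (let: ex_intro2 M M0 MA := bounded_op_gt0 (A i) in
  ex_intro (fun M => 0 < M /\ forall x, `|A i x| <= M * `|x|) M (conj M0 MA))).
pose m := \sum_i M i + 1.
have m0 : 0 < m.
  by rewrite ltr_wpDl//; apply: sumr_ge0 => i _; rewrite ltW//; case: (ME i).
have Mm i : M i <= m.
  rewrite /m (bigD1 i)//= -addrA lerDl addr_ge0//.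
  by apply: sumr_ge0 => j _; rewrite ltW//; case: (ME j).
have dm : 0 < d + m by rewrite addr_gt0.
(* [g] is the square of the coefficient of [y]; it solves [g m = d (1 - g)], which keeps the moments
   required of [v] within [d]. *)
pose g := d / (d + m); have g0 : 0 < g by rewrite divr_gt0.
have g1 : g < 1 by rewrite ltr_pdivrMr// mul1r ltrDl.
have gm : g * m = d * (1 - g) by rewrite /g; field; rewrite gt_eqF.
exists g => [|s e bs]; first by rewrite g0.
have [os bsB] := bs.
set x := residual s e; pose y := `|x|^-1 *: x.
have xy : x = `|x| *: y.
  have [->|x0] := eqVneq x 0; first by rewrite normr0 scale0r.
  by rewrite scalerA mulfV ?normr_eq0// scale1r.
(* Only an inequality, since [y = 0] when the residual vanishes; [b2] below makes up for it so that
   [u] is still a unit vector. *)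
have y1 : `|y| ^+ 2 <= 1.
  rewrite /y; have [->|x0] := eqVneq x 0; first by rewrite scaler0 normr0 expr0n.
  by rewrite normrZ normfV normr_id mulVf ?normr_eq0// expr1n.
have xyE : inner x y = `|x|.
  rewrite /y; have [->|x0] := eqVneq x 0; first by rewrite inner0l normr0.
  rewrite innerZr -sqr_norm_inner (CrealP _) ?rpredV ?normr_real//.
  by rewrite expr2 mulKf// normr_eq0.
have ys u : u \in s -> inner y u = 0 by move=> us; rewrite innerZl residual_orth// mulr0.
clearbody y.
have [n sn nB] := (proj2 admB) (size s).
(* The length of the padding puts the new vector exactly at the index [n]. *)
have [t [bt tn tF]] := @partial_basis_pad s (neighbours A [:: y]) (n - size s) bs.
have st : size (s ++ t) = n by rewrite size_cat tn subnKC// ltnW.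
have yt u : u \in t -> [/\ inner u y = 0, forall i, inner (A i y) u = 0 &
    forall i, inner (A i u) y = 0].
  move=> ut; apply: (@neighbours_orth _ _ _ A _ [:: y]); rewrite ?mem_head// => f.
  exact: tF.
pose b2 := 1 - g * `|y| ^+ 2.
have b2g : 1 - g <= b2 by rewrite lerD2l lerN2 -[leRHS]mulr1 ler_wpM2l// ltW.
have b20 : 0 < b2 by apply: lt_le_trans b2g; rewrite subr_gt0.
have lamd i : `|- (g * inner (A i y) y / b2)| <= d.
  rewrite normrN normrM normfV (gtr0_norm b20) ler_pdivrMr//.
  apply: (@le_trans _ _ (d * (1 - g))); last by rewrite ler_wpM2l// ltW.
  rewrite -gm normrM (gtr0_norm g0) ler_wpM2l//; first exact: ltW.
  apply: le_trans (Cauchy_Schwarz _ _) _; have [Mi0 MA] := ME i.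
  apply: (@le_trans _ _ (M i * `|y| ^+ 2)).
    by rewrite expr2 mulrA ler_wpM2r.
  apply: le_trans (Mm i); rewrite -[leRHS]mulr1 ler_wpM2l//; exact: ltW.
have [v [v1 vF vv]] := realize (neighbours A (y :: s ++ t)) lamd.
pose c := sqrtC g; pose b := sqrtC b2.
have c2 : c ^+ 2 = g by rewrite sqrtCK.
have bE : b ^+ 2 = b2 by rewrite sqrtCK.
have c0 : 0 <= c by rewrite sqrtC_ge0 ltW.
have b0 : 0 <= b by rewrite sqrtC_ge0 ltW.
have cr : c^*%R = c by apply/CrealP; exact: ger0_real.
have br : b^*%R = b by apply/CrealP; exact: ger0_real.
have vo u : u \in y :: s ++ t -> [/\ inner v u = 0, forall i, inner (A i u) v = 0 &
    forall i, inner (A i v) u = 0] by apply: neighbours_orth.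
have [vy Ayv Avy] := vo y (mem_head _ _).
have vst u : u \in s ++ t -> [/\ inner v u = 0, forall i, inner (A i u) v = 0 &
    forall i, inner (A i v) u = 0] by move=> ust; apply: vo; rewrite inE ust orbT.
pose u := c *: y + b *: v.
have Au i : A i u = c *: A i y + b *: A i v by rewrite bounded_opD !bounded_opZ.
have u1 : `|u| = 1.
  apply/eqP; rewrite -(@eqrXn2 _ 2)// expr1n pythagoras; last first.
    by rewrite innerZl innerZr (inner_eq0C vy) !mulr0.
  rewrite (normrZ c) (normrZ b) v1 mulr1 exprMn (ger0_norm c0) (ger0_norm b0).
  by rewrite c2 bE addrC subrK.
have uo z : z \in s ++ t -> inner u z = 0.
  move=> zst; rewrite innerDl !innerZl; have [-> _ _] := vst z zst.
  move: zst; rewrite mem_cat => /orP[zs|zt]; first by rewrite ys// !mulr0 addr0.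
  by have [yz _ _] := yt z zt; rewrite (inner_eq0C yz) !mulr0 addr0.
have bu : partial_basis (rcons (s ++ t) u).
  apply: partial_basis_rcons => //.
  - move=> i; rewrite Au innerDl !innerZl !innerDr !innerZr cr br Ayv Avy.
    by rewrite !mulr0 addr0 add0r vv !mulrA -!expr2 c2 bE; field; rewrite gt_eqF.
  - move=> j i; rewrite st => jn Bnj; rewrite innerDr !innerZr.
    have [_ -> _] := vst _ (mem_nth 0 (ltac:(by rewrite st) : (j < size (s ++ t))%N)).
    (* Admissibility excludes pairs with the old vectors; for the padding the inner product vanishes
       by genericity. *)
    rewrite nth_cat; case: ltnP => js; first by have [_ /(_ Bnj)] := nB j (ltnW js).
    have [|_ _ ->] := yt t`_(j - size s); last by rewrite !mulr0 addr0.
    by rewrite mem_nth// tn ltn_sub2r.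
  - move=> j i; rewrite st => jn Bnj; rewrite Au innerDl !innerZl.
    have [_ _ ->] := vst _ (mem_nth 0 (ltac:(by rewrite st) : (j < size (s ++ t))%N)).
    rewrite nth_cat; case: ltnP => js; first by have [/(_ Bnj)] := nB j (ltnW js).
    have [|_ -> _] := yt t`_(j - size s); last by rewrite !mulr0 addr0.
    by rewrite mem_nth// tn ltn_sub2r.
exists (rcons t u); rewrite -rcons_cat size_rcons; split=> //.
rewrite norm_residual_rcons//.
have -> : inner e u = c * `|x|.
  rewrite -(@inner_residual _ _ s); last by move=> z zs; apply: uo; rewrite mem_cat zs.
  rewrite -/x innerDr !innerZr cr br {2}xy xyE innerZl (inner_eq0C vy) !mulr0 addr0.
  by [].
rewrite mulrBl mul1r lerB ?norm_residual_cat//; first by case: bt.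
by rewrite normrM normr_id exprMn ger0_norm ?c2.
Qed.

(** Iterating [partial_basis_step], with the Bernoulli-type bound [(1 - g)^N <= 1 / (1 + N g)] in
    place of a limit of powers. *)
Lemma partial_basis_shrink s e (eta : R[i]) : partial_basis s -> 0 < eta ->
  exists t, partial_basis (s ++ t) /\ `|residual (s ++ t) e| ^+ 2 <= eta.
Proof.
move=> bs eta0; have [g /andP[g0 g1] step] := partial_basis_step.
set X := `|residual s e| ^+ 2; have X0 : 0 <= X by rewrite exprn_ge0.
have iter N : exists t, partial_basis (s ++ t) /\
    `|residual (s ++ t) e| ^+ 2 * (1 + N%:R * g) <= X.
  elim: N => [|N [t [bt tX]]]; first by exists [::]; rewrite cats0 mul0r addr0 mulr1.
  have [t' [bt' _ t'X]] := step _ e bt.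
  exists (t ++ t'); rewrite catA; split=> //; apply: le_trans tX.
  have Ng : 0 <= 1 + N.+1%:R * g by rewrite addr_ge0 ?mulr_ge0// ltW.
  apply: le_trans (ler_wpM2r Ng t'X) _.
  rewrite mulrC mulrA [leRHS]mulrC ler_wpM2r ?exprn_ge0//.
  rewrite -subr_ge0 (_ : _ - _ = N.+1%:R * g ^+ 2); last by rewrite -natr1; ring.
  by rewrite mulr_ge0// exprn_ge0// ltW.
have [|N NX] := @natSinv_lt R (eta * g / (X + 1)).
  by rewrite divr_gt0 ?mulr_gt0// ltr_wpDl.
have [t [bt tX]] := iter N.+1; exists t; split=> //.
have Ng : 0 < 1 + N.+1%:R * g by rewrite addr_gt0 ?mulr_gt0 ?ltr0n.
rewrite -(ler_pM2r Ng); apply: le_trans tX _.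
have := NX N (leqnn N); rewrite ltr_pdivlMr ?ltr_wpDl// ltr_pdivrMl ?ltr0n// => lt1.
apply: (@le_trans _ _ (X + 1)); first by rewrite lerDl.
apply: le_trans (ltW lt1) _; rewrite mulrDr mulr1 mulrCA lerDr.
exact: ltW.
Qed.

(** The vectors are treated in turn; extending the family never increases a residual already made
    small. *)
Lemma partial_basis_shrink_all s (es : seq H) (eta : R[i]) :
  partial_basis s -> 0 < eta ->
  exists t, partial_basis (s ++ t) /\
    forall e, e \in es -> `|residual (s ++ t) e| ^+ 2 <= eta.
Proof.
move=> bs eta0; elim: es => [|e es [t [bt tE]]]; first by exists [::]; rewrite cats0.
have [t' [bt' t'E]] := partial_basis_shrink e bt eta0.
exists (t ++ t'); rewrite catA; split=> // z; rewrite inE => /predU1P[->//|/tE].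
by apply: le_trans; apply: norm_residual_cat; case: bt'.
Qed.

(** Stage n brings the residuals of [e 0], ..., [e n] below a bound tending to 0 and adds at least
    one vector, so the nested finite families exhaust all indices. *)
Lemma exists_basis_sequence (e : nat -> H) : exists u : nat -> H,
  [/\ forall i j, inner (u i) (u j) = (i == j)%:R,
    forall n j, (B `|` diagonal) (n, j) -> forall i, inner (A i (u j)) (u n) = 0 &
    forall q (eta : R[i]), 0 < eta -> exists N,
      `|e q - \sum_(i < N) inner (e q) (u i) *: u i| ^+ 2 < eta].
Proof.
have next (p : nat * seq H) : exists t, partial_basis p.2 ->
    [/\ partial_basis (p.2 ++ t), (0 < size t)%N &
      forall q, (q <= p.1)%N -> `|residual (p.2 ++ t) (e q)| ^+ 2 <= p.1.+1%:R^-1].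
  have [b|nb] := pselect (partial_basis p.2); last by exists [::].
  have [g _ step] := partial_basis_step.
  (* Applied to the vector 0, the step only serves to lengthen the family. *)
  have [t [bt t0 _]] := step _ 0 b.
  have [|t' [bt' t'E]] := @partial_basis_shrink_all _
      [seq e q | q <- iota 0 p.1.+1] (p.1.+1%:R^-1) bt.
    by rewrite invr_gt0 ltr0n.
  exists (t ++ t') => _; rewrite catA size_cat ltn_addr//; split=> // q qp.
  by apply: t'E; apply: map_f; rewrite mem_iota.
have [f fP] := choice next.
pose S := fix S n := if n is m.+1 then S m ++ f (m, S m) else [::].
have Sb n : partial_basis (S n).
  by elim: n => [|n IH] //=; have [] := fP (n, S n) IH.
have Ssize n : (n <= size (S n))%N.
  elim: n => // n IH; rewrite /= size_cat; have [_ /= f0 _] := fP (n, S n) (Sb n).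
  by rewrite -addn1 leq_add.
have Scat n m : exists t, S (n + m)%N = S n ++ t.
  elim: m => [|m [t tE]]; first by exists [::]; rewrite addn0 cats0.
  by exists (t ++ f ((n + m)%N, S (n + m)%N)); rewrite addnS /= {1}tE catA.
have Snth n m i : (i < size (S n))%N -> (n <= m)%N -> (S m)`_i = (S n)`_i.
  by move=> iS /subnKC <-; have [t ->] := Scat n (m - n)%N; rewrite nth_cat iS.
(* [S i.+1] has more than [i] entries, and later stages keep them unchanged. *)
pose u i := (S i.+1)`_i.
have uE n i : (i < size (S n))%N -> u i = (S n)`_i.
  move=> iS; have [ni|/ltnW ni] := leqP n i.+1; first by rewrite /u (Snth n).
  by rewrite (Snth i.+1)//; exact: Ssize.
have big2 i j : (i < size (S (maxn i j).+1))%N /\ (j < size (S (maxn i j).+1))%N.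
  by split; apply: leq_trans (Ssize _); rewrite ltnS ?leq_maxl ?leq_maxr.
exists u; split=> [i j|n j nj i|q eta eta0].
- by have [iS jS] := big2 i j; rewrite (uE _ _ iS) (uE _ _ jS) (proj1 (Sb _)).
- by have [nS jS] := big2 n j; rewrite (uE _ _ nS) (uE _ _ jS) (proj2 (Sb _)).
have [N NE] := natSinv_lt eta0; pose n := maxn q N; exists (size (S n.+1)).
apply: le_lt_trans (NE n (leq_maxr _ _)).
have [_ _ /(_ q (leq_maxl _ _))] := fP (n, S n) (Sb n).
rewrite -[_ ++ _]/(S n.+1) /residual (big_nth 0) big_mkord.
by under [in X in X -> _]eq_bigr => i _ do rewrite -(uE _ _ (ltn_ord i)).
Qed.

End Construction.

(** * From a dense sequence to the orthonormal basis *)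

Lemma separable_sequence (X : ptopologicalType) : separable X ->
  exists e : nat -> X, dense (range e).
Proof.
move=> [D /countable_injP[f fI] dD].
exists (fun n => xget point [set x | D x /\ f x = n]) => O O0 oO.
have [x [Ox Dx]] := dD O O0 oO; exists x; split=> //; exists (f x) => //.
case: xgetP => [y -> [Dy fyx]|/(_ x) []//].
by apply: fI => //; rewrite inE.
Qed.

Lemma sequence_basis (R : realType) (H : hilbertType R) (e u : nat -> H) :
  dense (range e) -> (forall i j, inner (u i) (u j) = (i == j)%:R) ->
  (forall q (eta : R[i]), 0 < eta -> exists N,
      `|e q - \sum_(i < N) inner (e q) (u i) *: u i| ^+ 2 < eta) ->
  orthonormal_basis u.
Proof.
move=> de ou eu; split=> //; apply/seteqP; split=> // x _ O /nbhs_ballP[eps /= eps0 xO].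
have e2 : 0 < eps / 2 by rewrite divr_gt0.
have [|z [xz [q _ zE]]] := de (ball x (eps / 2)) _ (ball_open _ _).
  by exists x; exact: ballxx.
rewrite -{}zE in xz; have [N] := eu q _ (exprn_gt0 2 e2).
set y := \sum_(i < N) _; rewrite ltr_pXn2r ?nnegrE ?(ltW e2)// => ey.
exists y; split.
  by exists N, (fun i => inner (e q) (u i)), (fun i => u i).
apply: xO; move: xz; rewrite -!ball_normE /= => xz.
by apply: le_lt_trans (ler_distD (e q) _ _) _; rewrite [ltRHS]splitr ltrD.
Qed.

Theorem corollary6p5 (R : realType) (H : hilbertType R)
    (sepH : separable H) (infH : infinite_dimensional H)
    (T : bounded_op H) (invT : invertible T)
    (B : set (nat * nat)) (admB : admissible B)
    (r s : R) (r0 : 0 < r) (rs : r < s)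
    (circlesT : [set s%:C * z | z in @unit_circle R]
                `|` [set r%:C * z | z in @unit_circle R]
                `<=` essential_spectrum T)
    (k : nat) (k1 : (1 <= k)%N) :
  exists2 u : nat -> H, orthonormal_basis u &
    forall l : int, 1 <= `|l| <= k%:Z ->
    forall n j : nat, (B `|` diagonal) (n, j) ->
      inner (int_power T l (u j)) (u n) = 0.
Proof.
have onT (rho : R) (z : R[i]) : 0 < rho -> `|z| = rho%:C ->
    exists2 y, unit_circle y & rho%:C * y = z.
  move=> rho0 zn; have rho1 : rho%:C != 0 by rewrite gt_eqF// (ltcR 0).
  exists (z / rho%:C); last by rewrite mulrC divfK.
  rewrite /unit_circle /= normrM normfV norm_real_complex (gtr0_norm rho0) zn.
  by rewrite divff.
have [||z zn|d d0 dT] := @exact_moments R H T k r%:C s%:C invT.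
- by rewrite (ltcR 0).
- by rewrite ltcR.
- apply: circlesT; case: zn => zn; [right|left]; apply: onT => //.
  exact: lt_trans rs.
have [e de] := separable_sequence sepH.
(* The exponent 0 is left out: its moment is 1 for every unit vector and cannot be prescribed. *)
pose I : finType := {m : 'I_(k.*2.+1) | m != k :> nat}.
pose A (i : I) := int_power T (exponent (val i)).
have realize (F : seq H) (lam : I -> R[i]) : (forall i, `|lam i| <= d) ->
    exists v, [/\ `|v| = 1, forall f, f \in F -> inner v f = 0 &
      forall i, inner (A i v) v = lam i].
  move=> lamd; pose lam' m := if insub m is Some i then lam i else 0.
  have [m mk|v [v1 vF vE]] := dT F lam'.
    by rewrite /lam'; case: insub => [i|]; rewrite ?normr0 ?(ltW d0).
  by exists v; split=> // i; rewrite vE ?(valP i)// /lam' valK.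
have [u [ou uB ud]] := exists_basis_sequence d0 realize admB e.
exists u; first exact: (sequence_basis de ou ud).
move=> l /andP[l1 lk] n j nj.
(* The exponent [l] sits at index [l + k], which differs from [k] because [l] is nonzero. *)
have lN : (absz (l + k%:Z)%R < k.*2.+1)%N by lia.
have lm : Ordinal lN != k :> nat by rewrite /=; lia.
have -> : l = exponent (Ordinal lN) by rewrite /exponent /=; lia.
exact: (uB n j nj (exist _ (Ordinal lN) lm)).
Qed.
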